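(* Let $k$ be a positive integer, let $G$ be a bipartite multigraph with bipartition $(X,Y)$, and let $f$ be an integer-valued function on $V(G)$ satisfying $\sum_{v\in Y}f(v)\equiv\sum_{v\in X}f(v)\pmod k$. Let $F$, $F_0$, and $T$ be three pairwise edge-disjoint factors of $G$ such that for each $v\in X$, $$d_F(v)+\frac{d_T(v)}{2}\le f(v)\le d_G(v)-d_{F_0}(v)-\frac{d_T(v)}{2}.$$ If $T$ is $(3k-3)$-edge-connected, then there exists a factor $H$ of $G$ containing all edges of $F$ and no edges of $F_0$ such that: (1) for each $v\in X$, $d_{H}(v)=f(v)$; (2) for each $v\in Y$, $d_H(v)\equiv f(v)\pmod k$ and $\frac{1}{2}d_T(v)-k<\min \{d_H(v)-d_F(v),\,d_{H_0}(v)-d_{F_0}(v)\}$, where $H_0=G\setminus E(H)$.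
   Context: A factor is a spanning subgraph; multigraphs may have multiple edges. *)

(* Defs.v *)
From HB Require Import structures.
From mathcomp Require Import all_boot all_order all_algebra.

Set Implicit Arguments.
Unset Strict Implicit.
Unset Printing Implicit Defensive.

Import Order.TTheory GRing.Theory Num.Theory.

(* Finite loopless multigraphs: distinct edges may have the same ends. *)
Record multigraph := Multigraph {
  vertex : finType;
  edge : finType;
  ends : edge -> {set vertex};
  card_ends : forall e, #|ends e| = 2
}.

Definition bipartition (G : multigraph) (X Y : {set vertex G}) : Prop :=
  [/\ X :|: Y = setT, [disjoint X & Y] &
      forall e : edge G, exists x y, [/\ x \in X, y \in Y & ends e = [set x; y]]].

(* A spanning subgraph is determined by its edge set; G itself is [set: edge G]. *)
Definition factor (G : multigraph) := {set edge G}.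

Definition deg (G : multigraph) (A : factor G) (v : vertex G) : nat :=
  #|[set e in A | v \in ends e]|.

Definition adj (G : multigraph) (A : factor G) : rel (vertex G) :=
  fun u v => [exists e in A, ends e == [set u; v]].

Definition connected (G : multigraph) (A : factor G) : Prop :=
  forall u v : vertex G, connect (adj A) u v.

(* Deleting fewer than m edges never disconnects the factor; in particular,
   every factor is 0-edge-connected. *)
Definition edge_connected (G : multigraph) (m : nat) (A : factor G) : Prop :=
  forall D : {set edge G}, D \subset A -> #|D| < m -> connected (A :\: D).

(* Main.v *)
(* After moving one unused edge into [T] at each odd
   vertex of [X], the function equal to 1 on [F] (and on some further edges), to 1/2 on [T] and to 0
   elsewhere has the right degree at every vertex of [X]; it remains to add a perturbation [g] on [T],
   with [|g| <= 1/2], balanced on [X], whose excess [w] on [Y] lies in a prescribed coset of [k Z^Y]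
   and satisfies [|w| < k].  Degrees are then integers and total unimodularity of bipartite incidence
   matrices turns the fractional factor into a factor.

   To find [g], attach a terminal to each vertex of [Y] by a bundle of parallel edges and split off
   (Lovasz) all original vertices: flows lift back through a splitting, so one works in a multigraph
   [m] on the terminals, with small degrees and large cuts.  For [k <= 2] an orientation with
   prescribed parities of the out-degrees suffices.  For [k >= 3] all edges are doubled, all degrees
   are at most [4 k] and all cuts at least [4 k].  Maximising the product of [c_e ^ (m_e (n - 1))]
   against a power of the determinant of the weighted Laplacian yields conductances [c] for which the
   effective resistances satisfy [c_e R_e < m_e / 2k].  A vector [w] of minimal energy in its coset is
   the divergence of an electrical flow; comparing [w] with [w -+ k (e_u - e_v)] bounds the potential
   differences by [k R / 2], hence the flow on [e] by [m_e / 4] and [|w|] by [k]. *)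

Require Import Defs.
From HB Require Import structures.
From mathcomp Require Import all_boot all_order all_algebra.
From mathcomp Require Import ring lra zify.

Set Implicit Arguments.
Unset Strict Implicit.
Unset Printing Implicit Defensive.

Import Order.TTheory GRing.Theory Num.Theory.
Local Open Scope ring_scope.

(** * Splitting off *)

Section Splitting.
Variable V : finType.
Implicit Types (m : V -> V -> nat) (S W : {set V}) (s t u v : V).

Definition loopless_sym m : Prop := (forall u v, m u v = m v u) /\ (forall u, m u u = 0%N).

Definition mdeg m u := (\sum_v m u v)%N.

(* Twice the number of edges leaving [S]: summing over ordered pairs lets cut inequalities be
   checked termwise. *)
Definition dcut m S := (\sum_u \sum_v m u v * ((u \in S) (+) (v \in S)))%N.

Definition separates S W := [exists u in W, u \in S] && [exists u in W, u \notin S].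

Definition cut_cond m W l := [forall S : {set V}, separates S W ==> (2 * l <= dcut m S)%N].

(** Each of the [m u v] parallel edges has capacity [kap]; [F] is the net flow on the whole bundle
    and [w] its divergence, positive at sources. *)
Definition routable (kap : rat) m (w : V -> rat) : Prop := exists F : V -> V -> rat,
  [/\ forall u v, F v u = - F u v, forall u v, `|F u v| <= kap * (m u v)%:R &
      forall u, \sum_v F u v = w u].

(** Parities of degrees are recorded because the cosets prescribed at the terminals are shifted by
    half of the degree. Only flows, not the graph itself, have to be transported back from [m'] to
    [m]. *)
Definition reduction m m' : Prop :=
  [/\ loopless_sym m', forall v, (mdeg m' v <= mdeg m v)%N,
      forall v, odd (mdeg m' v) = odd (mdeg m v) &
      forall kap w, 0 <= kap -> routable kap m' w -> routable kap m w].

Lemma reduction_refl m : loopless_sym m -> reduction m m.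
Proof. by split. Qed.

Lemma reduction_trans m1 m2 m3 : reduction m1 m2 -> reduction m2 m3 -> reduction m1 m3.
Proof.
move=> [_ d12 o12 r12] [l3 d23 o23 r23]; split=> // [v|v|kap w k0 /(r23 _ _ k0)].
- exact: leq_trans (d12 v).
- by rewrite o23.
- exact: r12.
Qed.

Lemma dcutE m S : loopless_sym m -> dcut m S = (2 * \sum_(u in S) \sum_(v in ~: S) m u v)%N.
Proof.
move=> [ms _]; rewrite /dcut (bigID (mem S)) /= mul2n -addnn; congr (_ + _)%N.
  apply: eq_bigr => u uS; rewrite [RHS]big_mkcond; apply: eq_bigr => v _.
  by rewrite uS inE; case: (v \in S); rewrite ?muln0 ?muln1.
rewrite [RHS]exchange_big /=; apply: eq_big => [u|u uS]; first by rewrite inE.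
rewrite [RHS]big_mkcond; apply: eq_bigr => v _.
by rewrite (negPf uS) ms; case: (v \in S); rewrite ?muln0 ?muln1.
Qed.

Lemma dcutC m S : dcut m (~: S) = dcut m S.
Proof.
by apply: eq_bigr => u _; apply: eq_bigr => v _; rewrite !inE addNb addbN negbK.
Qed.

Lemma separatesC S W : separates (~: S) W = separates S W.
Proof.
rewrite /separates andbC; congr (_ && _); apply: eq_existsb => u; rewrite inE //.
by rewrite negbK.
Qed.

Lemma separates_sub S W W' : W \subset W' -> separates S W -> separates S W'.
Proof.
move=> /subsetP WW' /andP[/existsP[u /andP[uW uS]] /existsP[v /andP[vW vS]]].
by apply/andP; split; apply/existsP; [exists u|exists v]; rewrite WW'.
Qed.

Lemma cut_cond_sub m W W' l : W \subset W' -> cut_cond m W' l -> cut_cond m W l.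
Proof.
move=> WW' /forallP c; apply/forallP => S; apply/implyP => /(separates_sub WW') h.
by have := c S; rewrite h.
Qed.

Definition edge1 (x y a b : V) : nat := ((a == x) && (b == y)) + ((a == y) && (b == x)).

Lemma edge1C x y a b : edge1 x y a b = edge1 x y b a.
Proof. by rewrite /edge1 addnC [(a == y) && _]andbC [(a == x) && _]andbC. Qed.

Lemma sum_edge1 x y a : (\sum_b edge1 x y a b = (a == x) + (a == y))%N.
Proof.
rewrite big_split /=; congr (_ + _)%N.
  rewrite (bigD1 y) //= eqxx andbT big1 ?addn0 // => b /negPf->; by rewrite andbF.
by rewrite (bigD1 x) //= eqxx andbT big1 ?addn0 // => b /negPf->; rewrite andbF.
Qed.

Lemma sum2_edge1 (f : V -> V -> nat) x y :
  (\sum_a \sum_b edge1 x y a b * f a b = f x y + f y x)%N.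
Proof.
rewrite pair_bigA /=; under eq_bigr do rewrite mulnDl.
rewrite big_split /=; congr (_ + _)%N.
  rewrite (bigD1 (x, y)) //= !eqxx mul1n big1 ?addn0 // => -[a b] /=.
  by rewrite xpair_eqE => /negPf->.
rewrite (bigD1 (y, x)) //= !eqxx mul1n big1 ?addn0 // => -[a b] /=.
by rewrite xpair_eqE => /negPf->.
Qed.

Lemma dcut_edge1 x y S : dcut (edge1 x y) S = (2 * ((x \in S) (+) (y \in S)))%N.
Proof. by rewrite /dcut sum2_edge1 [in X in (_ + X)%N]addbC mul2n addnn. Qed.

(** One edge [s t] and one edge [s u] are replaced by an edge [t u]. The factor [t != u] discards
    the loop that would appear when the two edges are parallel. *)
Definition split_off m s t u (a b : V) : nat :=
  (m a b - edge1 s t a b - edge1 s u a b + (t != u) * edge1 t u a b)%N.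

Section SplitOff.
Variables (m : V -> V -> nat) (s t u : V).
Hypotheses (lm : loopless_sym m) (st : (0 < m s t)%N) (su : (0 < m s u)%N)
  (stu : (t == u) ==> (1 < m s t)%N).
Local Notation m' := (split_off m s t u).

Lemma split_off_neq : s != t /\ s != u.
Proof. by split; [apply: contraTneq st|apply: contraTneq su] => <-; rewrite lm.2. Qed.

(** The additive form holds because the truncated subtractions in [split_off] are exact: both edges
    are present, and twice if they are parallel. *)
Lemma split_offE a b :
  (m' a b + (edge1 s t a b + edge1 s u a b) = m a b + (t != u) * edge1 t u a b)%N.
Proof.
have le : (edge1 s t a b + edge1 s u a b <= m a b)%N.
  have [nst nsu] := split_off_neq; rewrite /edge1.
  case: (eqVneq a s) => [->|as_]; case: (eqVneq b s) => [->|bs] /=.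
  - by rewrite ?(negPf nst) ?(negPf nsu).
  - rewrite !andbF ?addn0; case: (eqVneq b t) => [->|bt]; case: (eqVneq _ u) => [E|bu] //=.
    + by move: stu; rewrite E eqxx.
    + by rewrite E.
  - rewrite !andbT !add0n lm.1; case: (eqVneq a t) => [->|bt]; case: (eqVneq _ u) => [E|bu] //=.
    + by move: stu; rewrite E eqxx.
    + by rewrite E.
  - by rewrite !andbF.
by rewrite /split_off -subnDA addnAC subnK.
Qed.

Lemma split_off_loopless : loopless_sym m'.
Proof.
split=> [a b|a]; first by rewrite /split_off lm.1 !(edge1C _ _ a b).
rewrite /split_off lm.2 /= /edge1; case: (eqVneq t u) => //= tu.
by case: (eqVneq a t) => [->|_]; rewrite ?(negPf tu) ?andbF.
Qed.

Lemma mdeg_split_off a :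
  (mdeg m' a + ((a == s) + (a == t) + ((a == s) + (a == u))) =
   mdeg m a + (t != u) * ((a == t) + (a == u)))%N.
Proof.
rewrite -!sum_edge1 big_distrr /= -!big_split /=; apply: eq_bigr => b _.
exact: split_offE.
Qed.

Lemma dcut_split_off S :
  (dcut m' S + (2 * ((s \in S) (+) (t \in S)) + 2 * ((s \in S) (+) (u \in S))) =
   dcut m S + 2 * ((t \in S) (+) (u \in S)))%N.
Proof.
have -> : (2 * ((t \in S) (+) (u \in S)) = (t != u) * (2 * ((t \in S) (+) (u \in S))))%N.
  by case: (eqVneq t u) => [->|_]; rewrite ?addbb ?mul1n.
rewrite -!dcut_edge1 /dcut -!big_split /= big_distrr -big_split /=.
apply: eq_bigr => a _; rewrite big_distrr -!big_split /=; apply: eq_bigr => b _.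
by rewrite mulnA -!mulnDl split_offE.
Qed.

Definition dart (x y a b : V) : rat := ((a == x) && (b == y))%:R - ((a == y) && (b == x))%:R.

Lemma sum_dart x y a : \sum_b dart x y a b = (a == x)%:R - (a == y)%:R.
Proof.
rewrite sumrB; congr (_ - _).
  rewrite (bigD1 y) //= eqxx andbT big1 ?addr0 // => b /negPf->; by rewrite andbF.
by rewrite (bigD1 x) //= eqxx andbT big1 ?addr0 // => b /negPf->; rewrite andbF.
Qed.

(** The share of the flow carried by one copy of the new edge [t u] is rerouted along [t], [s], [u].
    This share is at most [kap], the capacity of each of the two edges restored. If [t] equals [u],
    splitting only removed edges and the flow is kept. *)
Lemma split_off_routable kap w : 0 <= kap -> routable kap m' w -> routable kap m w.
Proof.
move=> k0 [F [Fa Fb Fs]]; have [nst nsu] := split_off_neq.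
have [tu|ntu] := eqVneq t u.
  exists F; split=> // a b; apply: le_trans (Fb a b) _; apply: ler_wpM2l => //.
  rewrite ler_nat; have := split_offE a b; rewrite tu eqxx; lia.
pose th := F t u / (m' t u)%:R.
have mtu : m' t u = (m t u).+1.
  have := split_offE t u; rewrite ntu /edge1 !eqxx !(eq_sym _ s) (negPf nst) (negPf nsu) /=.
  by rewrite ?(negPf ntu) /= ?andbF; lia.
have Mp : 0 < (m' t u)%:R :> rat by rewrite mtu ltr0n.
have th_le : `|th| <= kap.
  by rewrite /th normrM normfV (ger0_norm (ltW Mp)) ler_pdivrMr.
have FE : F t u = th * (m' t u)%:R by rewrite /th divfK // gt_eqF.
exists (fun a b => F a b + th * (dart t s a b + dart s u a b - dart t u a b)); split.
- move=> a b; rewrite Fa /dart !(andbC (b == _)); ring.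
- have bnd2 : `|F t u - th| <= kap * (m t u)%:R.
    have -> : F t u - th = th * (m t u)%:R by rewrite FE mtu -natr1; ring.
    by rewrite normrM normr_nat ler_wpM2r.
  move=> a b; rewrite /dart.
  case: (boolP ((a == t) && (b == u))) => [/andP[/eqP-> /eqP->]|tu].
    rewrite !(eq_sym _ s) (negPf nst) (negPf nsu) ?eqxx (negPf ntu) /= ?andbF ?(subrr, subr0, add0r, sub0r, mulrN1).
    exact: bnd2.
  case: (boolP ((a == u) && (b == t))) => [/andP[/eqP-> /eqP->]|ut].
    rewrite !(eq_sym _ s) (negPf nst) (negPf nsu) [u == t]eq_sym (negPf ntu) /= ?andbF ?(subrr, subr0, add0r, sub0r, opprK, mulr1).
    by rewrite (Fa t u) addrC distrC (lm.1 u t).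
  have E := split_offE a b; rewrite subrr subr0.
  have -> : m a b = (m' a b + (edge1 s t a b + edge1 s u a b))%N.
    by rewrite E /edge1 (negPf tu) (negPf ut) muln0 addn0.
  apply: le_trans (ler_normD _ _) _; rewrite natrD [leRHS]mulrDr; apply: lerD => //.
  rewrite normrM; apply: ler_pM => //; rewrite natrD; apply: le_trans (ler_normD _ _) _.
  apply: lerD; rewrite /edge1 natrD; apply: le_trans (ler_normB _ _) _; rewrite !normr_nat //.
  by rewrite addrC.
- move=> a; rewrite big_split /= Fs -mulr_sumr sumrB big_split /= !sum_dart; ring.
Qed.

End SplitOff.

(** Moving [s] into [S] exchanges, in the cut, the edges from [s] to [S] for all other edges at
    [s]. *)
Lemma dcut_add_vertex m s S : loopless_sym m -> s \notin S ->
  (dcut m (s |: S) + 4 * \sum_(v in S) m s v = dcut m S + 2 * mdeg m s)%N.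
Proof.
move=> [ms m0] sS.
have sumS (f : V -> nat) : (\sum_a \sum_b (a == s) * f b = \sum_b f b)%N.
  rewrite (bigD1 s) //= eqxx [X in (_ + X)%N]big1 ?addn0; first by apply: eq_bigr => b _; rewrite mul1n.
  by move=> a /negPf->; rewrite big1.
have -> : (4 * \sum_(v in S) m s v = \sum_a \sum_b
    (2 * ((a == s) * (m s b * (b \in S))) + 2 * ((b == s) * (m s a * (a \in S)))))%N.
  have E : (\sum_(v in S) m s v = \sum_b m s b * (b \in S))%N.
    by rewrite big_mkcond; apply: eq_bigr => b _; case: (b \in S); rewrite ?muln1 ?muln0.
  have sumT (f : V -> nat) : (\sum_a \sum_b 2 * ((a == s) * f b) = 2 * \sum_b f b)%N.
    by rewrite -(sumS f) big_distrr /=; apply: eq_bigr => a _; rewrite big_distrr.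
  transitivity (\sum_a \sum_b 2 * ((a == s) * (m s b * (b \in S))) +
     \sum_a \sum_b 2 * ((b == s) * (m s a * (a \in S))))%N; last first.
    by rewrite -big_split; apply: eq_bigr => a _; rewrite -big_split.
  by rewrite [X in (_ + X)%N]exchange_big /= !(sumT (fun b => m s b * (b \in S))%N) E; lia.
have -> : (2 * mdeg m s = \sum_a \sum_b ((a == s) * m s b + (b == s) * m s a))%N.
  transitivity (\sum_a \sum_b (a == s) * m s b + \sum_a \sum_b (b == s) * m s a)%N; last first.
    by rewrite -big_split; apply: eq_bigr => a _; rewrite -big_split.
  by rewrite [X in (_ + X)%N]exchange_big /= !sumS /mdeg; lia.
rewrite /dcut -!big_split /=; apply: eq_bigr => a _; rewrite -!big_split /=.
apply: eq_bigr => b _; rewrite !inE.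
have [->|as_] := eqVneq a s; have [->|bs] := eqVneq b s; rewrite ?m0 //=.
- by rewrite (negPf sS); case: (b \in S) => /=; lia.
- by rewrite (negPf sS) (ms a s); case: (a \in S) => /=; lia.
Qed.

(** A three-set submodularity: for every edge, the six membership bits of its ends show that the
    right side counts it at least as often as the left. An edge [s t] lies in all three cuts on the
    right but in only one on the left, which gives the surplus. *)
Lemma dcut_three m (X Y Z : {set V}) s t : loopless_sym m ->
  t \in X :&: Y :&: Z -> s \notin X :|: Y :|: Z ->
  (dcut m (X :&: Y :&: Z) + dcut m (X :\: (Y :|: Z)) + dcut m (Y :\: (X :|: Z)) +
   dcut m (Z :\: (X :|: Y)) + 4 * m s t <= dcut m X + dcut m Y + dcut m Z)%N.
Proof.
move=> [ms _] tI sU.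
have st : s != t.
  by apply: contraNneq sU => ->; move: tI; rewrite !inE => /andP[/andP[->]].
have -> : (4 * m s t = \sum_a \sum_b edge1 s t a b * (2 * m a b))%N.
  by rewrite (sum2_edge1 (fun a b => 2 * m a b)%N) (ms t s); lia.
rewrite /dcut -!big_split /=; apply: leq_sum => a _; rewrite -!big_split /=.
apply: leq_sum => b _; rewrite mulnCA mulnA [(_ * m a b)%N]mulnC -!mulnDr leq_mul2l; apply/orP; right.
move: tI sU; rewrite !inE /edge1 !negb_or => /andP[/andP[tX tY] tZ] /andP[/andP[sX sY] sZ].
case: (boolP ((a == s) && (b == t))) => [/andP[/eqP-> /eqP->]|n1].
  by rewrite (negPf st) tX tY tZ (negPf sX) (negPf sY) (negPf sZ).
case: (boolP ((a == t) && (b == s))) => [/andP[/eqP-> /eqP->]|n2].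
  by rewrite tX tY tZ (negPf sX) (negPf sY) (negPf sZ).
rewrite muln0 addn0.
move: (a \in X) (a \in Y) (a \in Z) (b \in X) (b \in Y) (b \in Z).
by do 6!case.
Qed.

End Splitting.

(** * Lovasz's splitting theorem *)

Section Lovasz.
Variable V : finType.
Implicit Types (m : V -> V -> nat) (S W : {set V}) (s t u v : V).

Definition can_split m s t u := (0 < m s u)%N && ((t == u) ==> (1 < m s t)%N).

Lemma other_neighbour m s t : (0 < m s t)%N -> ~~ odd (mdeg m s) ->
  exists u, can_split m s t u.
Proof.
move=> st ev.
case: (ltnP 1 (m s t)) => [st1|st1]; first by exists t; rewrite /can_split st st1 implybT.
have : (0 < \sum_(v | v != t) m s v)%N.
  move: ev; rewrite /mdeg (bigD1 t) //= (_ : m s t = 1%N); last by lia.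
  by rewrite oddD /= negbK => /odd_gt0.
rewrite lt0n sum_nat_eq0 negb_forall => /existsP[u]; rewrite negb_imply -lt0n => /andP[ut su].
by exists u; rewrite /can_split su eq_sym (negPf ut).
Qed.

Section OneSplit.
Variables (m : V -> V -> nat) (s t : V) (W : {set V}) (l : nat).
Hypotheses (lm : loopless_sym m) (st : (0 < m s t)%N) (ev : ~~ odd (mdeg m s))
  (sW : s \notin W) (nW : forall v, (0 < m s v)%N -> v \in W)
  (cc : cut_cond m W l) (l2 : (1 < l)%N).

(** These sets are the obstructions to splitting at [s] and [t]: splitting off [s t] and [s u] with
    [t] and [u] both in [S] lowers the cut of [S] by two edges, so a cut of at most [l + 1] edges
    falls below [l]. *)
Let danger S := [&& separates S W, t \in S, s \notin S & (dcut m S <= 2 * l + 2)%N].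

Hypothesis bad : forall u, can_split m s t u -> ~~ cut_cond (split_off m s t u) W l.

Lemma danger_avail u : can_split m s t u -> exists2 S, danger S & u \in S.
Proof.
move=> au; have /andP[su stu] := au.
have /forallPn[S] := bad au; rewrite negb_imply -ltnNge => /andP[sep lt].
have := forallP cc S; rewrite sep /= => ge.
have dE := dcut_split_off lm st su stu S.
(* [dcut] is even, so a value below [2 * l] is at most [2 * l - 2]; adding back the two lost edges
   yields [2 * l + 2]. *)
have dE' := dcutE S (split_off_loopless s t u lm).
have key : (s \in S) != (t \in S) /\ (s \in S) != (u \in S).
  by move: dE lt ge; case: (s \in S); case: (t \in S); case: (u \in S) => //=; lia.
have le : (dcut m S <= 2 * l + 2)%N.
  move: dE lt; case: key; rewrite dE'.
  by case: (s \in S); case: (t \in S); case: (u \in S) => //= _ _; lia.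
case: (boolP (t \in S)) => tS.
  exists S; last by case: key; rewrite tS; case: (s \in S); case: (u \in S).
  by rewrite /danger sep tS le; case: key; rewrite tS; case: (s \in S).
(* If the violated cut has [s] on its side, its complement contains [t] and [u] and avoids [s]. *)
exists (~: S); last by rewrite inE; case: key; rewrite (negPf tS); case: (s \in S); case: (u \in S).
rewrite /danger separatesC sep dcutC le !inE tS.
by case: key; rewrite (negPf tS); case: (s \in S).
Qed.

(** The only neighbour that cannot be split off with [t] is [t] itself when the edge [s t] is
    simple, and [t] lies in every dangerous set. *)
Lemma danger_cover u : (0 < m s u)%N -> exists2 S, danger S & u \in S.
Proof.
move=> su; case: (boolP (can_split m s t u)) => [/danger_avail //|].
rewrite /can_split su /= negb_imply => /andP[/eqP <- _].
have [v /danger_avail[S dS _]] := other_neighbour st ev.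
by exists S => //; case/and4P: dS.
Qed.

(** Adding [s] to [S] keeps it separating, so the new cut still has at least [l] edges while the old
    one has at most [l + 1]. The resulting bound is off by one, which the even degree of [s]
    repairs. *)
Lemma danger_half S : danger S -> (2 * \sum_(v in S) m s v <= mdeg m s)%N.
Proof.
move=> /and4P[sep tS sS le].
have := dcut_add_vertex lm sS.
have sep' : separates (s |: S) W.
  case/andP: sep => /existsP[u /andP[uW uS]] /existsP[v /andP[vW vS]].
  apply/andP; split; apply/existsP; first by exists u; rewrite uW !inE uS orbT.
  exists v; rewrite vW !inE negb_or vS andbT; by apply: contraNneq sW => <-.
have := forallP cc (s |: S); rewrite sep' /=.
by move: ev; move: (mdeg m s) => d; lia.
Qed.

(* A minimal cover of the neighbours of [s] by dangerous sets has three members, each with a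
   private neighbour, and these violate [dcut_three]. *)
Lemma no_bad_splitting : False.
Proof.
pose covers (C : {set {set V}}) :=
  [forall S in C, danger S] && [forall u, (0 < m s u)%N ==> [exists S in C, u \in S]].
have cov0 : covers [set S | danger S].
  apply/andP; split; first by apply/forallP => S; rewrite inE implybb.
  apply/forallP => u; apply/implyP => /danger_cover[S dS uS].
  by apply/existsP; exists S; rewrite inE dS.
case: (@arg_minnP _ [set S | danger S] covers (fun C => #|C|) cov0) => C /andP[Cd Cc] Cmin.
have priv S : S \in C -> exists2 u, (0 < m s u)%N & forall S', S' \in C -> u \in S' -> S' = S.
  move=> SC; case: (boolP [exists u, (0 < m s u)%N && [forall S' in C, (u \in S') ==> (S' == S)]]).
    case/existsP=> u /andP[su /forallP uP]; exists u => // S' S'C uS'.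
    by have := uP S'; rewrite S'C uS' => /eqP.
  move=> /existsPn no; have : covers (C :\ S).
    apply/andP; split.
      apply/forallP=> S'; apply/implyP => /setD1P[_ S'C].
      by have := forallP Cd S'; rewrite S'C.
    apply/forallP => u; apply/implyP => su; have := no u; rewrite su /=.
    case/forallPn => S'; rewrite !negb_imply => /and3P[S'C uS' nS].
    by apply/existsP; exists S'; rewrite !inE nS S'C.
  by move/Cmin; rewrite (cardsD1 S C) SC ltnn.
have dangerC S : S \in C -> danger S by move=> SC; have := forallP Cd S; rewrite SC.
(* One or two sets do not suffice: each receives at most half of the edges at [s], and [t] is
   counted in every member, so two sets would cover [mdeg m s + m s t] edges with only [mdeg m s]
   available. *)
have C3 : (2 < #|C|)%N.
  have h1 : (\sum_(S in C) 2 * \sum_(v in S) m s v <= \sum_(S in C) mdeg m s)%N.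
    by apply: leq_sum => S /dangerC /danger_half.
  rewrite sum_nat_const -big_distrr /= in h1.
  have C1 : (0 < #|C|)%N.
    have := forallP Cc t; rewrite st => /existsP[S /andP[SC _]].
    by apply/card_gt0P; exists S.
  have h2 : (mdeg m s + m s t * #|C|.-1 <= \sum_(S in C) \sum_(v in S) m s v)%N.
    have -> : (\sum_(S in C) \sum_(v in S) m s v = \sum_v m s v * #|[set S in C | v \in S]|)%N.
      rewrite (exchange_big_dep xpredT) //=; apply: eq_bigr => v _.
      by rewrite sum_nat_const mulnC; congr (_ * _)%N; apply: eq_card => S; rewrite !inE.
    rewrite /mdeg (bigD1 t) //= [leqRHS](bigD1 t) //= addnAC; apply: leq_add.
      have -> : [set S in C | t \in S] = C.
        by apply/setP=> S; rewrite inE andb_idr // => /dangerC /and4P[].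
      by rewrite -{2}(prednK C1) mulnS.
    apply: leq_sum => v _; case: (posnP (m s v)) => [->//|sv].
    rewrite -{1}[m s v]muln1 leq_mul2l; apply/orP; right.
    have := forallP Cc v; rewrite sv => /existsP[S /andP[SC vS]].
    by apply/card_gt0P; exists S; rewrite inE SC.
  have ds : (0 < mdeg m s)%N by rewrite /mdeg (bigD1 t) //= addn_gt0 st.
  rewrite ltnNge; apply/negP => C2.
  have : (#|C| = 1 \/ #|C| = 2)%N by lia.
  by case=> E; move: h1 h2; rewrite E /=; lia.
have /card_gt2P[X [Y [Z [[XC YC ZC] [XY YZ ZX]]]]] := C3.
have [x sx xP] := priv _ XC; have [y sy yP] := priv _ YC; have [z sz zP] := priv _ ZC.
have /and4P[_ tX sX dX] := dangerC _ XC.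
have /and4P[_ tY sY dY] := dangerC _ YC.
have /and4P[_ tZ sZ dZ] := dangerC _ ZC.
have inC u S S' : (forall S', S' \in C -> u \in S' -> S' = S) -> S' \in C -> S' != S -> u \notin S'.
  by move=> uP S'C; apply: contra => /uP->.
have memC u S : (0 < m s u)%N -> (forall S', S' \in C -> u \in S' -> S' = S) -> u \in S.
  move=> su uP; have := forallP Cc u; rewrite su => /existsP[S' /andP[S'C uS']].
  by rewrite -(uP _ S'C uS').
have sepI u v S : u \in W -> v \in W -> u \in S -> v \notin S -> (2 * l <= dcut m S)%N.
  move=> uW vW uS vS; have := forallP cc S; rewrite /separates.
  have -> : [exists u in W, u \in S] by apply/existsP; exists u; rewrite uW.
  by have -> : [exists u in W, u \notin S] by apply/existsP; exists v; rewrite vW.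
have tW := nW st.
have := @dcut_three _ m X Y Z s t lm.
rewrite !inE tX tY tZ (negPf sX) (negPf sY) (negPf sZ) => /(_ isT isT).
have xX := memC _ _ sx xP; have yY := memC _ _ sy yP; have zZ := memC _ _ sz zP.
have xY : x \notin Y by apply: inC xP YC _; rewrite eq_sym.
have xZ : x \notin Z by apply: inC xP ZC _.
have yX : y \notin X by apply: inC yP XC _.
have yZ : y \notin Z by apply: inC yP ZC _; rewrite eq_sym.
have zX : z \notin X by apply: inC zP XC _; rewrite eq_sym.
have zY : z \notin Y by apply: inC zP YC _.
have b1 : (2 * l <= dcut m (X :&: Y :&: Z))%N.
  by apply: (sepI t x); rewrite ?nW // !inE ?tX ?tY ?tZ // (negPf xY) andbF.
have b2 : (2 * l <= dcut m (X :\: (Y :|: Z)))%N.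
  by apply: (sepI x t); rewrite ?nW // !inE ?tX ?tY ?tZ // negb_or xY xZ.
have b3 : (2 * l <= dcut m (Y :\: (X :|: Z)))%N.
  by apply: (sepI y t); rewrite ?nW // !inE ?tX ?tY ?tZ // negb_or yX yZ.
have b4 : (2 * l <= dcut m (Z :\: (X :|: Y)))%N.
  by apply: (sepI z t); rewrite ?nW // !inE ?tX ?tY ?tZ // negb_or zX zY.
(* The inequality reads [8 l + 4 m s t <= 6 l + 6], impossible once [l >= 2] and [m s t >= 1]; for
   [l = 1] there would be no contradiction. *)
move: b1 b2 b3 b4 dX dY dZ st l2; clear.
move: (dcut _ _) (dcut _ _) (dcut _ _) (dcut _ _) (dcut _ _) (dcut _ _) (dcut _ _) (m s t).
by move=> *; lia.
Qed.
End OneSplit.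

(** Pairs of edges at [s] are split off until [s] is isolated; each splitting lowers the even degree
    of [s] by two. For [l = 0] there is no cut to protect and any pair will do. *)
Lemma split_hub m s W l : l = 0%N \/ (1 < l)%N -> loopless_sym m ->
  ~~ odd (mdeg m s) -> s \notin W -> (forall v, v != s -> (0 < mdeg m v)%N -> v \in W) ->
  cut_cond m W l ->
  exists m', [/\ reduction m m', mdeg m' s = 0%N & cut_cond m' W l].
Proof.
move=> hl; have [d] := ubnP (mdeg m s); elim: d m => // d IH m dlt lm ev sW nW cc.
have [s0|spos] := posnP (mdeg m s).
  by exists m; split=> //; apply: reduction_refl.
have [t st] : exists t, (0 < m s t)%N.
  by move: spos; rewrite lt0n sum_nat_eq0 => /forallPn[t]; rewrite -lt0n; exists t.
have nW' v : (0 < m s v)%N -> v \in W.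
  move=> sv; apply: nW; first by apply: contraTneq sv => ->; rewrite lm.2.
  by rewrite /mdeg (bigD1 s) //= lm.1 addn_gt0 sv.
have [u /andP[su stu] cc'] : exists2 u, can_split m s t u &
    cut_cond (split_off m s t u) W l.
  case: hl => [l0|l2].
    have [u au] := other_neighbour st ev; exists u => //.
    by apply/forallP => S; rewrite l0 muln0 implybT.
  case: (boolP [exists u, can_split m s t u &&
     cut_cond (split_off m s t u) W l]) => [/existsP[u /andP[]]|/existsPn no]; first by exists u.
  exfalso; apply: (no_bad_splitting lm st ev sW nW' cc l2) => u au.
  by have := no u; rewrite au.
have lm' := split_off_loopless s t u lm.
have dE := mdeg_split_off lm st su stu.
have [nst nsu] := split_off_neq lm st su.
have red : reduction m (split_off m s t u).
  split=> // [v|v|kap w k0].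
  - have := dE v; case: (eqVneq t u) => /= [<-|_]; case: (v == s); case: (v == t); lia.
  - have := dE v; case: (eqVneq t u) => /= [<-|_]; case: (v == s); case: (v == t); case: (v == u); lia.
  - exact: split_off_routable.
have [|||m' [red' d0 cc'']] := IH (split_off m s t u) _ lm' _ sW _ cc'.
- have := dE s; rewrite eqxx (negPf nst) (negPf nsu); lia.
- by case: red => _ _ ->.
- by move=> v vs vp; apply: nW => //; apply: leq_trans vp _; case: red.
by exists m'; split=> //; apply: reduction_trans red'.
Qed.

(** The hubs are isolated one at a time. Those still waiting in the list are treated as terminals,
    so that every neighbour of the current hub lies in the protected set. *)
Lemma split_hubs (H : seq V) m W l : l = 0%N \/ (1 < l)%N -> loopless_sym m -> uniq H ->
  {in H, forall s, ~~ odd (mdeg m s)} -> {in H, forall s, s \notin W} ->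
  (forall v, (0 < mdeg m v)%N -> v \in W :|: [set x in H]) ->
  cut_cond m (W :|: [set x in H]) l ->
  exists m', [/\ reduction m m', {in H, forall s, mdeg m' s = 0%N} & cut_cond m' W l].
Proof.
move=> hl; elim: H m => [|s H IH] m lm /=.
  move=> _ _ _ _ cc; exists m; split; [exact: reduction_refl|by move=> ?|].
  by apply: cut_cond_sub cc; rewrite subsetUl.
move=> /andP[sH uH] ev HW nW cc.
have [||||m1 [r1 d1 c1]] := @split_hub m s (W :|: [set x in H]) l hl lm.
- by apply: ev; rewrite mem_head.
- by rewrite !inE negb_or HW ?mem_head.
- by move=> v vs /nW; rewrite !inE (negPf vs).
- apply: cut_cond_sub cc; apply/subsetP => v; rewrite !inE => /orP[->//|->]; by rewrite !orbT.
have [l1 le1 o1 _] := r1.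
have [||||m2 [r2 d2 c2]] := IH m1 l1 uH.
- by move=> v vH; rewrite o1 ev // inE vH orbT.
- by move=> v vH; rewrite HW // inE vH orbT.
- move=> v vp; have := nW v (leq_trans vp (le1 v)); rewrite !inE.
  by case: eqVneq => // vs; move: vp; rewrite vs d1.
- exact: c1.
exists m2; split=> //; first exact: reduction_trans r2.
move=> v; rewrite inE => /predU1P[->|/d2 //].
by apply/eqP; rewrite -leqn0 -d1; case: r2.
Qed.
End Lovasz.

(** * Quadratic forms *)

(** The matrix determinant lemma: one block matrix is factored into triangular ones in two ways. *)
Lemma det1_mul_col_row (R : comNzRingType) n (u : 'cV[R]_n) (v : 'rV[R]_n) :
  \det (1%:M + u *m v) = 1 + (v *m u) 0 0.
Proof.
have E1 : block_mx 1%:M (- v) u 1%:M =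
    block_mx 1%:M 0 u 1%:M *m block_mx 1%:M (- v) 0 (1%:M + u *m v) :> 'M_(1 + n).
  by rewrite mulmx_block !mul1mx !mul0mx !mulmx1 !addr0 mulmxN addrC addrK.
have E2 : block_mx 1%:M (- v) u 1%:M =
    block_mx (1%:M + v *m u) (- v) 0 1%:M *m block_mx 1%:M 0 u 1%:M :> 'M_(1 + n).
  by rewrite mulmx_block !mul1mx !mul0mx !mulmx1 !mulmx0 !add0r mulNmx addrK.
have := congr1 determinant E1; rewrite {1}E2 !det_mulmx !det_lblock !det_ublock.
by rewrite !det1 !mul1r !mulr1 det_mx11 !mxE /=.
Qed.

Definition qform (n : nat) (A : 'M[rat]_n) (x : 'rV[rat]_n) : rat :=
  (x *m A *m x^T) 0 0.

(** Positive definiteness, stated as semidefiniteness with positive determinant because the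
    determinant is the quantity followed through rank-one updates. *)
Definition posform (n : nat) (A : 'M[rat]_n) : Prop :=
  [/\ A^T = A, forall x, 0 <= qform A x & 0 < \det A].

Section PosForm.
Variable n : nat.
Implicit Types (A : 'M[rat]_n) (v x y : 'rV[rat]_n) (t : rat).

Lemma posform_unit A : posform A -> A \in unitmx.
Proof. by case=> _ _ dA; rewrite unitmxE unitfE gt_eqF. Qed.

(** The form of the inverse at [v] is the form of [A] at [v *m invmx A]. *)
Lemma qform_inv_ge0 A v : posform A -> 0 <= qform (invmx A) v.
Proof.
move=> pA; have uA := posform_unit pA; case: pA => sA /(_ (v *m invmx A)) + _.
rewrite /qform trmx_mul trmx_inv sA !mulmxA.
by rewrite -[_ *m A in X in X -> _]mulmxA mulVmx // mulmx1.
Qed.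

Lemma qformD A x y : A^T = A ->
  qform A (x + y) = qform A x + 2%:R * (x *m A *m y^T) 0 0 + qform A y.
Proof.
move=> sA; rewrite /qform linearD /= mulmxDl mulmxDr !mulmxDl.
have E : (y *m A *m x^T) = (x *m A *m y^T)^T by rewrite !trmx_mul trmxK sA mulmxA.
rewrite E; set a := x *m A *m y^T; set b := x *m A *m x^T; set c := y *m A *m y^T.
by rewrite !mxE; ring.
Qed.

Lemma qformZ A t x : qform A (t *: x) = t ^+ 2 * qform A x.
Proof. by rewrite /qform linearZ /= -scalemxAr -!scalemxAl !mxE; ring. Qed.

Lemma qform_rank1 t v x :
  qform (t *: (v^T *m v)) x = t * ((x *m v^T) 0 0) ^+ 2.
Proof.
rewrite /qform -scalemxAr -scalemxAl.
have -> : x *m (v^T *m v) *m x^T = (x *m v^T) *m (x *m v^T)^T.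
  by rewrite trmx_mul trmxK !mulmxA.
move: (x *m v^T) => a; by rewrite !mxE big_ord1 mxE expr2.
Qed.

Lemma det_rank1_update A t v : A \in unitmx ->
  \det (A + t *: (v^T *m v)) = \det A * (1 + t * qform (invmx A) v).
Proof.
move=> uA; have -> : A + t *: (v^T *m v) = A *m (1%:M + (t *: (invmx A *m v^T)) *m v).
  rewrite mulmxDr mulmx1 -scalemxAl -scalemxAr !mulmxA mulmxV // mul1mx.
  by [].
by rewrite det_mulmx det1_mul_col_row -scalemxAr mxE mulmxA.
Qed.

Lemma posform_rank1_update A t v : posform A -> 0 <= t ->
  posform (A + t *: (v^T *m v)) /\ \det A <= \det (A + t *: (v^T *m v)).
Proof.
move=> pA t0; have le : \det A <= \det (A + t *: (v^T *m v)).
  rewrite det_rank1_update ?posform_unit // ler_peMr //; first by case: pA => _ _ /ltW.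
  by rewrite lerDl mulr_ge0 // qform_inv_ge0.
split=> //; case: pA => sA qA dA; split.
- by rewrite linearD linearZ /= trmx_mul trmxK sA.
- move=> x; rewrite /qform mulmxDr mulmxDl mxE addr_ge0 ?qA //.
  by have := qform_rank1 t v x; rewrite /qform => ->; rewrite mulr_ge0 ?sqr_ge0.
- exact: lt_le_trans le.
Qed.

Lemma posform_rank1_sum (I : Type) (r : seq I) (P : pred I) (c : I -> rat)
    (v : I -> 'rV[rat]_n) A :
  posform A -> (forall i, P i -> 0 <= c i) ->
  posform (A + \sum_(i <- r | P i) c i *: ((v i)^T *m v i)) /\
  \det A <= \det (A + \sum_(i <- r | P i) c i *: ((v i)^T *m v i)).
Proof.
move=> pA c0; elim: r => [|i r [pr lr]]; first by rewrite big_nil addr0.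
rewrite big_cons; case: ifP => // Pi.
rewrite addrCA addrC; have [p l] := posform_rank1_update (v i) pr (c0 _ Pi).
by split=> //; apply: le_trans l.
Qed.

End PosForm.

(** A nonnegative quantity with values in the multiples of [1 / N] cannot decrease forever. The
    partial map [better] proposes an improvement, and [None] means local minimality. *)
Lemma rat_descent (T : Type) (P : T -> Prop) (q : T -> rat) (N : nat) (t0 : T) :
  P t0 -> (0 < N)%N -> (forall t, P t -> 0 <= q t) ->
  (forall t, P t -> N%:R * q t \is a Num.int) ->
  forall (better : T -> option T),
  (forall t t', P t -> better t = Some t' -> P t' /\ q t' < q t) ->
  exists2 t, P t & better t = None.
Proof.
move=> Pt0 N0 q0 qint better bP.
suff: forall M t, P t -> N%:R * q t < M%:R -> exists2 t, P t & better t = None.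
  move=> /(_ _ t0 Pt0); apply.
  exact: (archi_boundP (mulr_ge0 (ler0n _ _) (q0 _ Pt0))).
elim=> [|M IH] t Pt lt.
  by have := mulr_ge0 (ler0n rat N) (q0 _ Pt); rewrite leNgt lt.
case E: (better t) => [t'|]; last by exists t.
have [Pt' qt'] := bP _ _ Pt E; apply: (IH t' Pt').
have : N%:R * q t' < N%:R * q t by rewrite ltr_pM2l // ltr0n.
move: (qint _ Pt) (qint _ Pt') lt => /intrP[a ->] /intrP[b ->].
rewrite -[M.+1%:R]/(M.+1%:Z%:~R) -[M%:R]/(M%:Z%:~R) !ltr_int => ? ?; lia.
Qed.

Lemma bernoulli_inv (x : rat) N : 0 <= x <= 1 -> (1 - x) ^+ N * (1 + N%:R * x) <= 1.
Proof.
move=> /andP[x0 x1]; elim: N => [|N IH]; first by rewrite expr0 mul0r addr0 mulr1.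
rewrite exprS -mulrA mulrCA; apply: le_trans IH.
apply: ler_wpM2l; first by rewrite exprn_ge0 // subr_ge0.
rewrite -natr1; have: 0 <= N%:R :> rat by []. move: N%:R => a a0; nra.
Qed.

Lemma bernoulli_sub (x : rat) N : 0 <= x <= 1 -> 1 - N%:R * x <= (1 - x) ^+ N.
Proof.
move=> /andP[x0 x1]; elim: N => [|N IH]; first by rewrite mul0r subr0.
rewrite exprS; apply: le_trans (ler_wpM2l _ IH); last by rewrite subr_ge0.
rewrite -natr1; have: 0 <= N%:R :> rat by []. move: N%:R => a a0; nra.
Qed.

(** * Determinants of weighted Laplacians *)

Section GreedyTree.
Variables (n K : nat) (m : 'I_n.+1 -> 'I_n.+1 -> nat).
Local Notation pair := ('I_n.+1 * 'I_n.+1)%type.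
Hypothesis m_sym : forall u v, m u v = m v u.
Hypothesis cut_m : forall S : {set 'I_n.+1}, S != set0 -> S != setT ->
  (2 * K <= \sum_(u in S) \sum_(v in ~: S) m u v)%N.
Hypothesis K_gt0 : (0 < K)%N.

(** The map [q] labels the vertices by the classes of a contraction; crossing pairs are those that
    survive it, each listed once in increasing order. *)
Definition crossing (q : 'I_n.+1 -> 'I_n.+1) (p : pair) : bool :=
  (p.1 < p.2)%N && (q p.1 != q p.2).

Definition crossing_size q := (\sum_(p | crossing q p) m p.1 p.2)%N.

(** Each class has a cut of at least [2 * K] edges, and summing over the classes counts every
    crossing edge twice. *)
Lemma crossing_size_ge q : (1 < #|q @: setT|)%N ->
  (K * #|q @: setT| <= crossing_size q)%N.
Proof.
move=> q1; rewrite -(leq_pmul2l (isT : 0 < 2)%N).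
have -> : (2 * crossing_size q = \sum_u \sum_(v | q v != q u) m u v)%N.
  rewrite pair_big_dep /= (bigID (fun p : pair => p.1 < p.2)%N) /= mul2n -addnn.
  congr (_ + _)%N.
    by apply: eq_bigl => -[u v] /=; rewrite /crossing /= eq_sym andbC.
  pose sw (p : pair) := (p.2, p.1).
  have swK : involutive sw by case.
  rewrite /crossing_size (reindex_inj (inv_inj swK)) /=.
  rewrite [RHS](eq_bigl (fun p => crossing q (sw p))); last first.
    move=> [u v]; rewrite /crossing /= andbC -leqNgt leq_eqVlt.
    by case: eqVneq => [/val_inj->|]; rewrite ?eqxx ?andbF.
  by apply: eq_bigr => -[u v] _ /=.
rewrite mulnA mulnC (partition_big_imset q) /=.
have -> : q @: 'I_n.+1 = q @: setT by apply/setP => b; apply/imsetP/imsetP => -[u _ ->]; exists u.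
rewrite -sum_nat_const; apply: leq_sum => b /imsetP[w _ bw].
pose S := [set u | q u == b].
have wS : w \in S by rewrite inE bw.
have S0 : S != set0 by apply/set0Pn; exists w.
have ST : S != setT.
  apply: contraTneq q1 => SE; rewrite -leqNgt -(cards1 b) subset_leq_card //.
  by apply/subsetP=> _ /imsetP[u _ ->]; have := in_setT u; rewrite -SE !inE.
apply: leq_trans (cut_m S0 ST) _; rewrite leq_eqVlt; apply/orP; left; apply/eqP.
apply: eq_big => [u|u uS]; first by rewrite inE.
by apply: eq_bigl => v; move: uS; rewrite !inE => /eqP->.
Qed.

Variable c : pair -> rat.
Hypothesis c_gt0 : forall p, (0 < m p.1 p.2)%N -> 0 < c p.

(* Kruskal's algorithm: contracting a crossing pair of largest weight loses nothing against the
   average over a multigraph all of whose cuts have at least [2 K] edges. *)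
Lemma greedy_tree r q (C : rat) : #|q @: setT| = r.+1 ->
  (forall p, crossing q p -> (0 < m p.1 p.2)%N -> c p <= C) ->
  exists es : seq pair, [/\ size es = r, uniq es,
    {in es, forall p, crossing q p && (0 < m p.1 p.2)%N},
    forall x : 'I_n.+1 -> rat, {in es, forall p, x p.1 = x p.2} ->
      (forall u v, q u = q v -> x u = x v) -> forall u v, x u = x v &
    \prod_(p | crossing q p) c p ^+ (m p.1 p.2 * n) <=
      (\prod_(p <- es) c p) ^+ (n.+1 * K) *
      C ^+ (crossing_size q * n - n.+1 * K * r)].
Proof.
elim: r q C => [|r IH] q C qr cC.
  have q1 u v : q u = q v.
    have /eqP/cards1P[b qb] := qr.
    have qu w : q w = b by apply/set1P; rewrite -qb imset_f.
    by rewrite !qu.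
  exists [::]; split=> //.
  - by move=> x _ xq u v; apply: xq.
  - have e0 p : crossing q p = false by rewrite /crossing (q1 p.1 p.2) eqxx andbF.
    rewrite /crossing_size !(eq_bigl _ _ e0) !big_pred0_eq big_nil.
    by rewrite muln0 expr1n mulr1.
have e_ge : (K * r.+2 <= crossing_size q)%N by rewrite -qr crossing_size_ge // qr.
have r_le : (r.+2 <= n.+1)%N by rewrite -qr -[X in (_ <= X)%N]card_ord max_card.
have [a0 a0P] : exists p : pair, crossing q p && (0 < m p.1 p.2)%N.
  have : (0 < crossing_size q)%N by apply: leq_trans e_ge; rewrite muln_gt0 K_gt0.
  rewrite lt0n sum_nat_eq0 negb_forall => /existsP[p].
  by rewrite negb_imply -lt0n => pP; exists p.
case: (@Order.TotalTheory.arg_maxP _ _ _ a0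
   (fun p : pair => crossing q p && (0 < m p.1 p.2)%N) c a0P) => a /andP[a_cr a_m] a_max.
(* Contracting [a] gives the class of [a.2] the label of [a.1], so exactly one label disappears. *)
pose q' w := if q w == q a.2 then q a.1 else q w.
have a12 : q a.1 != q a.2 by case/andP: a_cr.
have q'E : q' @: setT = (q @: setT) :\ q a.2.
  apply/setP=> b; rewrite in_setD1; apply/imsetP/andP => [[w _ ->]|[ba /imsetP[w _ bw]]].
    by rewrite /q'; case: ifPn => wa; split; rewrite ?imset_f.
  by exists w => //; rewrite /q' -bw (negPf ba).
have q'r : #|q' @: setT| = r.+1.
  by rewrite q'E; have := cardsD1 (q a.2) (q @: setT); rewrite qr imset_f // => -[].
have cr' p : crossing q' p -> crossing q p.
  rewrite /crossing /q' => /andP[-> /=]; apply: contraNneq => ->; exact: eqxx.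
have a_cr' : ~~ crossing q' a.
  by rewrite /crossing /q' eqxx (negPf a12) eqxx andbF.
have [p /cr' pc pm|es [es_r es_u es_c es_x es_w]] := IH q' (c a) q'r.
  by apply: a_max; rewrite pc.
exists (a :: es); split.
- by rewrite /= es_r.
- rewrite /= es_u andbT; apply: contra a_cr' => /es_c /andP[]; by [].
- move=> p; rewrite inE => /predU1P[->|/es_c /andP[/cr' -> ->]] //.
  by rewrite a_cr a_m.
- move=> x xe xq; apply: es_x => [p pe|u v].
    by apply: xe; rewrite inE pe orbT.
  have xa : x a.1 = x a.2 by apply: xe; rewrite mem_head.
  rewrite /q'; case: eqP => ua; case: eqP => va; try exact: xq.
  + by move=> _; apply: xq; rewrite ua.
  + by move=> av; rewrite -(xq _ _ av) xa; apply: xq.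
  + by move=> av; rewrite (xq _ _ av) xa; apply: xq.
have ca0 := c_gt0 a_m.
have caC : c a <= C by apply: cC.
set s := (crossing_size q * n - n.+1 * K * r.+1)%N.
(* The truncated subtraction in the exponent is exact: there are at least [K * (r + 2)] crossing
   edges, and [(n + 1) * (r + 1) <= n * (r + 2)] because [r + 1 <= n]. *)
have sE : (s + n.+1 * K * r.+1 = crossing_size q * n)%N.
  rewrite /s subnK //.
  have : (K * r.+2 * n <= crossing_size q * n)%N by rewrite leq_mul2r e_ge orbT.
  apply: leq_trans; rewrite -mulnA mulnAC mulnC -!mulnA leq_mul2l; apply/orP; right.
  by nia.
have e'_le : (crossing_size q' <= crossing_size q)%N.
  rewrite /crossing_size [leqRHS]big_mkcond [leqLHS]big_mkcond leq_sum // => p _.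
  by case: ifP => [/cr' ->|].
pose d := (\sum_(p | crossing q p && ~~ crossing q' p) m p.1 p.2)%N.
have eE : crossing_size q = (crossing_size q' + d)%N.
  rewrite /crossing_size (bigID (crossing q')) /=; congr (_ + _)%N.
  by apply: eq_bigl => p; rewrite andb_idl //; apply: cr'.
set s' := (crossing_size q' * n - n.+1 * K * r)%N in es_w.
have s'E : (s' + n.+1 * K * r = crossing_size q' * n)%N.
  rewrite /s' subnK //; case: (posnP r) => [->|r0]; first by rewrite muln0.
  have e'_ge : (K * r.+1 <= crossing_size q')%N by rewrite -q'r crossing_size_ge // q'r.
  have : (K * r.+1 * n <= crossing_size q' * n)%N by rewrite leq_mul2r e'_ge orbT.
  apply: leq_trans; rewrite -mulnA mulnAC mulnC -!mulnA leq_mul2l; apply/orP; right.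
  by nia.
(* The contraction removes [d] crossing edges. Their weights, with exponent [n], provide the factor
   [c a ^+ (n.+1 * K)] of the new tree edge, and the remaining powers of [c a] are bounded by powers
   of [C]. *)
have ssE : (n.+1 * K + s = s' + d * n)%N.
  by move: sE s'E; rewrite eE mulnDl mulnS; lia.
have dle : \prod_(p | crossing q p && ~~ crossing q' p) c p ^+ (m p.1 p.2 * n) <=
    c a ^+ (d * n).
  rewrite /d big_distrl /= -prodrXr; apply: ler_prod => p /andP[pc _].
  case: (posnP (m p.1 p.2)) => [->|pm]; first by rewrite mul0n !expr0 ler01 lexx.
  rewrite exprn_ge0 ?(ltW (c_gt0 pm)) //=.
  by apply: lerXn2r; rewrite ?nnegrE ?(ltW (c_gt0 pm)) ?(ltW ca0) //; apply: a_max; rewrite pc.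
have es0 : 0 <= \prod_(p <- es) c p.
  by rewrite big_seq prodr_ge0 // => p /es_c /andP[_ /c_gt0/ltW].
rewrite big_cons exprMn (bigID (crossing q')) /=.
have -> : \prod_(p | crossing q p && crossing q' p) c p ^+ (m p.1 p.2 * n) =
    \prod_(p | crossing q' p) c p ^+ (m p.1 p.2 * n).
  by apply: eq_bigl => p; rewrite andb_idl //; apply: cr'.
have nn p : 0 <= c p ^+ (m p.1 p.2 * n).
  case: (posnP (m p.1 p.2)) => [->|pm]; first by rewrite mul0n expr0.
  by rewrite exprn_ge0 // ltW // c_gt0.
apply: le_trans (ler_pM _ _ es_w dle) _; [exact: prodr_ge0..|].
rewrite -mulrA -exprD -ssE exprD mulrA [X in _ <= X * _]mulrC.
apply: ler_wpM2l; first by rewrite mulr_ge0 // exprn_ge0 // ltW.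
by apply: lerXn2r => //; rewrite nnegrE ?(ltW ca0) // (le_trans (ltW ca0)).
Qed.

Definition edge_vec (p : pair) : 'rV[rat]_n.+1 := delta_mx 0 p.1 - delta_mx 0 p.2.

Lemma mul_edge_vec p (x : 'cV[rat]_n.+1) : (edge_vec p *m x) 0 0 = x p.1 0 - x p.2 0.
Proof. by rewrite /edge_vec mulmxBl -!rowE !mxE. Qed.

(** The weighted graph Laplacian grounded at vertex [0]: the extra rank-one term excludes nonzero
    constant vectors from the kernel. *)
Definition laplacian (c : pair -> rat) : 'M[rat]_n.+1 :=
  (delta_mx 0 0)^T *m (delta_mx 0 0 : 'rV_n.+1) +
  \sum_(p : pair | (p.1 < p.2)%N && (0 < m p.1 p.2)%N) c p *: ((edge_vec p)^T *m edge_vec p).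

(** The matrix is [B^T D B] with [B] the integer matrix of the grounding row and the tree edges. A
    kernel vector of [B] is constant along the tree and zero at [0], so [B] is nonsingular and the
    square of its integer determinant is at least 1. *)
Lemma tree_laplacian (es : seq pair) : size es = n ->
  (forall x : 'I_n.+1 -> rat, {in es, forall p, x p.1 = x p.2} -> forall u v, x u = x v) ->
  {in es, forall p, 0 < c p} ->
  let A := (delta_mx 0 0)^T *m (delta_mx 0 0 : 'rV_n.+1) +
    \sum_(p <- es) c p *: ((edge_vec p)^T *m edge_vec p) in
  posform A /\ \prod_(p <- es) c p <= \det A.
Proof.
move=> es_n es_x c0 A.
pose p0 : pair := (0, 0).
pose Z : 'M[int]_n.+1 := \matrix_(i, j)
  (if i == 0 then (j == 0)%:R
   else (j == (nth p0 es i.-1).1)%:R - (j == (nth p0 es i.-1).2)%:R).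
pose B : 'M[rat]_n.+1 := map_mx intr Z.
pose d : 'rV[rat]_n.+1 := \row_i (if i == 0 then 1 else c (nth p0 es i.-1)).
have rowB0 : row 0 B = delta_mx 0 0.
  by apply/rowP=> j; rewrite !mxE eqxx /= rmorph_nat.
have rowBS (i : 'I_n) : row (lift 0 i) B = edge_vec (nth p0 es i).
  by apply/rowP=> j; rewrite !mxE /= rmorphB /= !rmorph_nat.
have AE : A = B^T *m diag_mx d *m B.
  have -> : B^T *m diag_mx d *m B = \sum_i d 0 i *: ((row i B)^T *m row i B).
    apply/matrixP=> i j; rewrite summxE mxE; apply: eq_bigr => k _.
    rewrite mul_mx_diag !mxE big_ord1 !mxE; ring.
  rewrite big_ord_recl rowB0 mxE eqxx scale1r; congr (_ + _).
  rewrite (big_nth p0) es_n big_mkord; apply: eq_bigr => i _.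
  by rewrite rowBS mxE /=.
have dB : \det B != 0.
  rewrite -det_tr; apply/det0P => -[v v0 vB].
  have Bv : B *m v^T = 0 by apply: trmx_inj; rewrite trmx_mul trmxK vB linear0.
  have rB i : (row i B *m v^T) 0 0 = 0 by rewrite -row_mul Bv !mxE.
  have v00 : v 0 0 = 0 by have := rB 0; rewrite rowB0 -rowE !mxE.
  have vc : forall i j, v 0 i = v 0 j.
    apply: (es_x (fun i => v 0 i)) => p /(nthP p0)[i]; rewrite es_n => i_n <-.
    have := rB (lift 0 (Ordinal i_n)); rewrite rowBS mul_edge_vec !mxE /=.
    by move/eqP; rewrite subr_eq0 => /eqP.
  by move/eqP: v0; apply; apply/rowP => i; rewrite (vc i 0) v00 mxE.
have dB2 : 1 <= \det B ^+ 2.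
  move: dB; rewrite det_map_mx intr_eq0 -rmorphXn /= ler1z => dZ.
  by have : 0 < \det Z ^+ 2; [rewrite lt_def sqrf_eq0 dZ sqr_ge0|lia].
have dA : \det A = \det B ^+ 2 * \prod_(p <- es) c p.
  rewrite AE !det_mulmx det_tr det_diag big_ord_recl !mxE eqxx mul1r mulrAC -expr2.
  congr (_ * _); rewrite (big_nth p0) es_n big_mkord.
  by apply: eq_bigr => i _; rewrite mxE.
have pr0 : 0 < \prod_(p <- es) c p by rewrite big_seq prodr_gt0.
have le : \prod_(p <- es) c p <= \det A by rewrite dA ler_peMl // ltW.
split=> //; split; last exact: lt_le_trans le.
- rewrite AE !trmx_mul trmxK tr_diag_mx mulmxA; by [].
- move=> x; rewrite AE /qform.
  have -> : x *m (B^T *m diag_mx d *m B) *m x^T =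
     (x *m B^T) *m diag_mx d *m (x *m B^T)^T by rewrite trmx_mul trmxK !mulmxA.
  rewrite mxE sumr_ge0 // => i _; rewrite mul_mx_diag !mxE mulrAC mulr_ge0 //.
    by rewrite -expr2 sqr_ge0.
  case: ifPn => // i0; apply/ltW/c0/mem_nth; rewrite es_n.
  by case: i i0 => -[|i].
Qed.

(** The greedy tree, started from the discrete partition, gives a positive definite form. The other
    edges are nonnegative rank-one updates, which never lower the determinant. *)
Lemma laplacian_posform : posform (laplacian c) /\
  ((forall p, (0 < m p.1 p.2)%N -> c p <= 1) ->
   \prod_(p : pair | (p.1 < p.2)%N && (0 < m p.1 p.2)%N) c p ^+ (m p.1 p.2 * n) <=
   \det (laplacian c) ^+ (n.+1 * K)).
Proof.
have idE : #|id @: [set: 'I_n.+1]| = n.+1 by rewrite imset_id cardsT card_ord.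
have [C CP] : exists C, forall p, (0 < m p.1 p.2)%N -> c p <= C.
  case: (@Order.TotalTheory.arg_maxP _ _ _ (0, 0) xpredT c isT) => a _ aP.
  by exists (c a) => p _; apply: aP.
(* The bound [C'] is kept general: positivity uses the largest weight, while the determinant bound
   uses [C' = 1] to make the leftover power disappear. *)
have key C' : (forall p, (0 < m p.1 p.2)%N -> c p <= C') -> posform (laplacian c) /\
   (C' = 1 -> \prod_(p : pair | (p.1 < p.2)%N && (0 < m p.1 p.2)%N) c p ^+ (m p.1 p.2 * n) <=
   \det (laplacian c) ^+ (n.+1 * K)).
  move=> cC; have [p _|es [es_n es_u es_c es_x es_w]] := greedy_tree idE (C := C').
    exact: cC.
  have [|p|pA lA] := tree_laplacian es_n.
  - by move=> x xe; apply: es_x => // u v ->.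
  - by move=> /es_c /andP[_ /c_gt0].
  set A := (X in posform X) in pA lA.
  have LE : laplacian c = A + \sum_(p : pair | ((p.1 < p.2)%N && (0 < m p.1 p.2)%N) && (p \notin es))
       c p *: ((edge_vec p)^T *m edge_vec p).
    rewrite /laplacian /A -addrA; congr (_ + _).
    rewrite (bigID (mem es)) /=; congr (_ + _).
    rewrite big_uniq //=; apply: eq_bigl => p; rewrite andb_idl //.
    by move/es_c; rewrite /crossing -andbA => /and3P[-> _ ->].
  have [|pL lL] := posform_rank1_sum (index_enum _) (c := c)
    (P := fun p : pair => ((p.1 < p.2)%N && (0 < m p.1 p.2)%N) && (p \notin es)) edge_vec pA.
    by move=> p /andP[/andP[_ /c_gt0/ltW]].
  rewrite -LE in pL lL; split=> // C1.
  apply: le_trans (lerXn2r _ _ _ (le_trans lA lL)); last first.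
  - by rewrite nnegrE; case: pL => _ _ /ltW.
  - by rewrite nnegrE big_seq prodr_ge0 // => p /es_c /andP[_ /c_gt0/ltW].
  move: es_w; rewrite C1 expr1n mulr1; apply: le_trans.
  rewrite [leRHS](bigID (fun p : pair => 0 < m p.1 p.2)%N) /= [X in _ <= _ * X]big1.
    rewrite mulr1 le_eqVlt; apply/orP; left; apply/eqP; apply: eq_bigl => p.
    rewrite /crossing; case: ltngtP => //=; by case: p => u v /= /ltn_eqF; rewrite -val_eqE /= => ->.
  by move=> p /andP[_]; rewrite -eqn0Ngt => /eqP->.
split; first by case: (key C CP).
by move=> c1; case: (key 1 c1) => _; apply.
Qed.

End GreedyTree.

(** * Conductances with small effective resistances *)

Section Conductances.
Variables (n K : nat) (m : 'I_n.+1 -> 'I_n.+1 -> nat).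
Local Notation pair := ('I_n.+1 * 'I_n.+1)%type.
Hypothesis m_sym : forall u v, m u v = m v u.
Hypothesis cut_m : forall S : {set 'I_n.+1}, S != set0 -> S != setT ->
  (2 * K <= \sum_(u in S) \sum_(v in ~: S) m u v)%N.
Hypothesis K_gt0 : (0 < K)%N.
Local Notation lap := (laplacian m).

Lemma laplacian_update (c c' : pair -> rat) (p : pair) (t : rat) :
  (p.1 < p.2)%N -> (0 < m p.1 p.2)%N -> c' p = c p + t ->
  (forall r, r != p -> c' r = c r) ->
  lap c' = lap c + t *: ((edge_vec p)^T *m edge_vec p).
Proof.
move=> p12 pm c'p c'r; rewrite /laplacian -addrA; congr (_ + _).
rewrite (bigD1 p) ?p12 ?pm //= [in RHS](bigD1 p) ?p12 ?pm //= c'p [RHS]addrAC -scalerDl.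
congr (_ + _).
by apply: eq_bigr => r /andP[_ /c'r ->].
Qed.

(* As long as some pair violates the bound, lowering its weight by the factor [1 - eta] multiplies
   the quotient [prod c_e ^ (m_e n) / det ^ ((n + 1) K)] by at least [1 + eta / 2]; but this
   quotient never exceeds 1. *)
Lemma exists_conductance : exists c : pair -> rat,
  (forall p, (0 < m p.1 p.2)%N -> 0 < c p) /\
  (forall p : pair, (p.1 < p.2)%N -> (0 < m p.1 p.2)%N ->
    c p * qform (invmx (lap c)) (edge_vec p) < (m p.1 p.2)%:R / K%:R).
Proof.
pose b := (\sum_(p : pair) m p.1 p.2)%N.
have mb p : (m p.1 p.2 <= b)%N by rewrite /b (bigD1 p) //= leq_addr.
(* The step is small enough that [eta * m_e * n * (n + 1) <= 1 / 2] for every pair, which absorbs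
   the quadratic error in one update; it also yields [eta * m_e <= 1] and [eta <= 1 / 2]. *)
pose eta : rat := (2 * b.+1 * n.+1 * n.+1)%N%:R ^-1.
have eta0 : 0 < eta by rewrite invr_gt0 ltr0n.
have etaM : eta * (2 * b.+1 * n.+1 * n.+1)%N%:R = 1 by rewrite mulVf // pnatr_eq0.
have eta_m p : eta * (m p.1 p.2)%:R * n%:R * n.+1%:R <= 2%:R^-1.
  have : eta * (2 * (m p.1 p.2) * n * n.+1)%N%:R <= 1.
    rewrite -[leRHS]etaM ler_pM2l // ler_nat; have := mb p; nia.
  by rewrite !natrM; lra.
have eta_1 p : eta * (m p.1 p.2)%:R <= 1.
  rewrite -[leRHS]etaM ler_pM2l // ler_nat; have := mb p; nia.
have eta1 : eta <= 2%:R^-1.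
  have : eta * 2%:R <= 1 by rewrite -[leRHS]etaM ler_pM2l // ler_nat; nia.
  lra.
pose c (j : pair -> nat) (p : pair) := (1 - eta) ^+ j p.
have rho0 : 0 < 1 - eta by lra.
have c0 j p : 0 < c j p by rewrite exprn_gt0.
have c1 j p : c j p <= 1 by rewrite exprn_ile1 //; lra.
have lapP j := laplacian_posform m_sym cut_m K_gt0 (c := c j) (fun p _ => c0 j p).
have D0 j : 0 < \det (lap (c j)) by case: (lapP j) => -[].
pose PP j := \prod_(p : pair | (p.1 < p.2)%N && (0 < m p.1 p.2)%N) c j p ^+ (m p.1 p.2 * n).
have PD j : PP j <= \det (lap (c j)) ^+ (n.+1 * K).
  by case: (lapP j) => _; apply=> p _; apply: c1.
pose j0 : pair -> nat := fun _ => 0%N.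
pose goal := exists c : pair -> rat,
  (forall p, (0 < m p.1 p.2)%N -> 0 < c p) /\
  (forall p : pair, (p.1 < p.2)%N -> (0 < m p.1 p.2)%N ->
    c p * qform (invmx (lap c)) (edge_vec p) < (m p.1 p.2)%:R / K%:R).
have grow i : goal \/ exists j,
   (1 + i%:R * (eta / 2%:R)) * \det (lap (c j)) ^+ (n.+1 * K) <=
   PP j * \det (lap (c j0)) ^+ (n.+1 * K).
  elim: i => [|i [IH|[j IH]]]; [right; exists j0|by left|].
    rewrite mul0r addr0 mul1r /PP big1 ?mul1r // => p _.
    by rewrite /c expr0 expr1n.
  case: (boolP [forall p : pair, ((p.1 < p.2)%N && (0 < m p.1 p.2)%N) ==>
     (c j p * qform (invmx (lap (c j))) (edge_vec p) < (m p.1 p.2)%:R / K%:R)]).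
    move=> /forallP good; left; exists (c j); split=> [p _|p p12 pm]; first exact: c0.
    by have := good p; rewrite p12 pm.
  rewrite negb_forall => /existsP[p]; rewrite negb_imply -leNgt => /andP[/andP[p12 pm] bad].
  right; pose j' r := if r == p then (j p).+1 else j r.
  have c'p : c j' p = c j p + (- eta * c j p).
    by rewrite /c /j' eqxx exprS; ring.
  have c'r r : r != p -> c j' r = c j r by rewrite /c /j' => /negPf->.
  exists j'; set M := m p.1 p.2 in bad pm *; set a : rat := M%:R.
  have a0 : 1 <= a by rewrite ler1n.
  have a_gt0 : 0 < a by lra.
  set s := qform _ _ in bad.
  have K0 : 0 < K%:R :> rat by rewrite ltr0n.
  have D' : \det (lap (c j')) = \det (lap (c j)) * (1 - eta * (c j p * s)).
    rewrite (laplacian_update p12 pm c'p c'r) det_rank1_update; last first.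
      by apply: posform_unit; case: (lapP j).
    by rewrite -/s; congr (_ * _); ring.
  have D'le : \det (lap (c j')) <= \det (lap (c j)) * (1 - eta * (a / K%:R)).
    by rewrite D' ler_pM2l // lerD2l lerN2 ler_pM2l.
  have P' : PP j' = PP j * (1 - eta) ^+ (M * n).
    rewrite /PP (bigD1 p) ?p12 ?pm //= [in RHS](bigD1 p) ?p12 ?pm //=.
    rewrite mulrAC -exprMn; congr (_ ^+ _ * _); first by rewrite c'p; ring.
    by apply: eq_bigr => r /andP[_ /c'r ->].
  have xK : eta * (a / K%:R) <= 1.
    have : eta * a <= 1 by apply: eta_1.
    rewrite mulrA ler_pdivrMr // mul1r => /le_trans; apply; by rewrite ler1n.
  have x0 : 0 <= eta * (a / K%:R) by rewrite mulr_ge0 ?divr_ge0 // ltW.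
  have B1 := @bernoulli_inv (eta * (a / K%:R)) (n.+1 * K) (introT andP (conj x0 xK)).
  have eta_le1 : eta <= 1 by lra.
  have B2 := @bernoulli_sub eta (M * n) (introT andP (conj (ltW eta0) eta_le1)).
  set y := (1 - eta * (a / K%:R)) ^+ (n.+1 * K) in B1.
  have y0 : 0 <= y by rewrite exprn_ge0 // subr_ge0.
  (* By the two Bernoulli bounds it suffices that [1 + eta / 2] is at most
     [(1 - eta a n) (1 + eta a (n + 1))]. The linear gain is [eta a], from [n + 1] against [n], and
     the quadratic loss is at most half of it. *)
  have step : (1 + eta / 2%:R) * y <= (1 - eta) ^+ (M * n).
    apply: le_trans B2; rewrite natrM -/a.
    move: B1; have -> : (n.+1 * K)%:R * (eta * (a / K%:R)) = eta * a * (n%:R + 1).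
      by rewrite natrM -natr1; field; rewrite gt_eqF.
    have := eta_m p; rewrite -/M -/a -natr1.
    have : 0 <= n%:R :> rat by []. move: (n%:R : rat) => N N0 h1 h2.
    have h3 : 0 <= 1 - a * N * eta.
      have : 0 <= eta * a * N * N by rewrite !mulr_ge0 // ltW.
      have -> : a * N * eta = eta * a * N * (N + 1) - eta * a * N * N by ring.
      move: h1; have -> : eta * a * N * (N + 1) = eta * a * N * (N + 1) by []. lra.
    apply: le_trans (_ : (1 - a * N * eta) * (y * (1 + eta * a * (N + 1))) <= _); last first.
      by rewrite ler_piMr.
    rewrite mulrCA mulrC; apply: ler_wpM2l => //.
    have : 0 <= (eta * a) * (2%:R^-1 - eta * a * N * (N + 1)).
      by rewrite mulr_ge0 ?subr_ge0 // mulr_ge0 // ltW.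
    have : eta <= eta * a by rewrite ler_peMr // ltW.
    by nra.
  have i0 : 0 <= i%:R :> rat by [].
  apply: le_trans (_ : ((1 + i%:R * (eta / 2%:R)) * \det (lap (c j)) ^+ (n.+1 * K)) *
       ((1 + eta / 2%:R) * y) <= _).
    rewrite mulrACA -exprMn; apply: ler_pM.
    - by rewrite addr_ge0 // mulr_ge0 // divr_ge0 // ltW.
    - by rewrite exprn_ge0 // ltW.
    - rewrite -natr1; have : 0 <= i%:R * (eta/2%:R) * (eta/2%:R).
        by rewrite !mulr_ge0 // ?divr_ge0 ?ltW.
      lra.
    - apply: lerXn2r => //; first by rewrite nnegrE ltW.
      by rewrite nnegrE mulr_ge0 ?subr_ge0 // ltW.
  rewrite P' [leRHS]mulrAC; apply: ler_pM => //.
  - by rewrite mulr_ge0 ?addr_ge0 ?mulr_ge0 ?divr_ge0 ?exprn_ge0 // ltW.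
  - by rewrite mulr_ge0 // addr_ge0 // divr_ge0 // ltW.
(* Since [PP j] is at most the power of the determinant for [c j], the growth factor after [i]
   rounds is bounded by the initial power of the determinant; a larger [i] forces the other
   alternative. *)
have [i ile] : exists i : nat, \det (lap (c j0)) ^+ (n.+1 * K) < 1 + i%:R * (eta / 2%:R).
  set z := _ ^+ _; have z0 : 0 <= z / (eta / 2%:R) by rewrite divr_ge0 ?divr_ge0 ?exprn_ge0 ?ltW.
  exists (Num.bound (z / (eta / 2%:R))); have := archi_boundP z0.
  by rewrite ltr_pdivrMr ?divr_gt0 //; lra.
case: (grow i) => // -[j]; have Dj := exprn_gt0 (n.+1 * K) (D0 j).
have Dz := exprn_gt0 (n.+1 * K) (D0 j0).
move=> /le_trans /(_ (ler_wpM2r (ltW Dz) (PD j))).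
by rewrite mulrC ler_pM2l // leNgt ile.
Qed.

End Conductances.

(** * Flows between terminals *)

Lemma common_denominator (I : finType) (a : I -> rat) :
  exists2 d : nat, (0 < d)%N & forall i, d%:R * a i \is a Num.int.
Proof.
exists (\prod_i `|denq (a i)|)%N.
  by apply: prodn_gt0 => i; rewrite absz_gt0 denq_neq0.
move=> i; rewrite (bigD1 i) //= natrM mulrAC.
have -> : `|denq (a i)|%:R * a i = (numq (a i))%:~R.
  by rewrite natr_absz ger0_norm ?denq_ge0 // mulrC numqE.
by rewrite rpredM ?intr_int // ?rpred_nat.
Qed.

Lemma laplacianE (n : nat) (m : 'I_n.+1 -> 'I_n.+1 -> nat)
    (c : 'I_n.+1 * 'I_n.+1 -> rat) (x : 'cV[rat]_n.+1) u :
  (laplacian m c *m x) u 0 = (u == 0)%:R * x 0 0 +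
    \sum_(p : 'I_n.+1 * 'I_n.+1 | (p.1 < p.2)%N && (0 < m p.1 p.2)%N)
      c p * (x p.1 0 - x p.2 0) * ((u == p.1)%:R - (u == p.2)%:R).
Proof.
rewrite /laplacian mulmxDl mulmx_suml mxE; congr (_ + _).
  rewrite -mulmxA -rowE mxE big_ord1 !mxE eqxx /=.
  by [].
rewrite summxE; apply: eq_bigr => p _.
rewrite -scalemxAl -mulmxA mxE [(_ *m (_ *m _)) _ _]mxE big_ord1 mul_edge_vec !mxE eqxx /=; ring.
Qed.

(** * Flows of minimal energy in a lattice coset *)

Section LatticeFlow.
Variables (n k : nat) (m : 'I_n.+1 -> 'I_n.+1 -> nat) (alpha : 'I_n.+1 -> rat) (z : int).
Local Notation pair := ('I_n.+1 * 'I_n.+1)%type.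
Hypothesis k_gt0 : (0 < k)%N.
Hypothesis m_sym : forall u v, m u v = m v u.
Hypothesis deg_m : forall u, (\sum_v m u v <= 4 * k)%N.
Hypothesis cut_m : forall S : {set 'I_n.+1}, S != set0 -> S != setT ->
  (4 * k <= \sum_(u in S) \sum_(v in ~: S) m u v)%N.
Hypothesis sum_alpha : \sum_u alpha u = k%:R * z%:~R.

Lemma lattice_flow : exists (w : 'I_n.+1 -> rat) (F : 'I_n.+1 -> 'I_n.+1 -> rat),
  [/\ forall u, exists t : int, w u = alpha u + k%:R * t%:~R,
      forall u v, F v u = - F u v,
      forall u v, `|F u v| <= (m u v)%:R / 4%:R,
      forall u, \sum_v F u v = w u &
      forall u, `|w u| < k%:R].
Proof.
have k0 : 0 < k%:R :> rat by rewrite ltr0n.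
have K0 : (0 < 2 * k)%N by rewrite muln_gt0.
have cut2 S : S != set0 -> S != setT ->
    (2 * (2 * k) <= \sum_(u in S) \sum_(v in ~: S) m u v)%N.
  by rewrite mulnA; apply: cut_m.
have [c [c0 cR]] := exists_conductance m_sym cut2 K0.
have [pL _] := laplacian_posform m_sym cut2 K0 c0.
set L := laplacian m c in cR pL.
have uL := posform_unit pL.
have sL : (invmx L)^T = invmx L by case: pL => sL _ _; rewrite trmx_inv sL.
pose coset (w : 'rV[rat]_n.+1) :=
  (forall u, exists t : int, w 0 u = alpha u + k%:R * t%:~R) /\ \sum_u w 0 u = 0.
(* A starting point of the coset: the whole excess [k * z] is removed at vertex [0], so that the
   entries sum to zero. *)
pose w0 : 'rV[rat]_n.+1 := \row_u (alpha u + k%:R * (if u == 0 then - z else 0)%:~R).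
have w0P : coset w0.
  split=> [u|]; first by rewrite mxE; eexists.
  under eq_bigr do rewrite mxE.
  rewrite big_split /= sum_alpha (bigD1 0) //= big1 ?addr0 ?rmorphN /= => [|i /negPf->]; last by rewrite mulr0.
  ring.
have [d1 d1_0 d1P] := common_denominator alpha.
have [d2 d2_0 d2P] := common_denominator (fun p : pair => invmx L p.1 p.2).
pose better (w : 'rV[rat]_n.+1) : option 'rV[rat]_n.+1 :=
  if [pick p : pair | qform (invmx L) (w - k%:R *: edge_vec p) < qform (invmx L) w]
  is Some p then Some (w - k%:R *: edge_vec p) else None.
have [w [wP wS] wB] : exists2 w, coset w & better w = None.
  (* The coset has entries with denominator [d1] and the inverse has entries with denominator [d2],
     so the energy takes values in the multiples of [1 / (d2 * d1 ^ 2)]. *)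
  apply: (@rat_descent _ coset (qform (invmx L)) (d2 * d1 ^ 2)%N w0 w0P).
  - by rewrite muln_gt0 d2_0 expn_gt0 d1_0.
  - by move=> w _; apply: qform_inv_ge0.
  - move=> w [wP _]; have dw u : d1%:R * w 0 u \is a Num.int.
      have [t ->] := wP u; rewrite mulrDr rpredD // !rpredM ?rpred_nat ?intr_int //.
    rewrite /qform mxE mulr_sumr rpred_sum // => i _; rewrite mxE mulr_suml mulr_sumr.
    rewrite rpred_sum // => j _; rewrite mxE.
    have -> : (d2 * d1 ^ 2)%:R * (w 0 j * invmx L j i * w 0 i) =
      (d1%:R * w 0 j) * (d2%:R * invmx L j i) * (d1%:R * w 0 i).
      rewrite natrM natrX; ring.
    by apply: rpredM (dw i); apply: rpredM (dw j) _; apply: (d2P (j, i)).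
  - move=> w w' [wP wS]; rewrite /better; case: pickP => // p lt [<-]; split=> //.
    split=> [u|].
      have [t wt] := wP u; exists (t - (((u == p.1)%:R - (u == p.2)%:R)))%R.
      by rewrite !mxE wt !rmorphB /= !rmorph_nat ?eqxx /=; ring.
    under eq_bigr do rewrite !mxE ?eqxx /=.
    rewrite big_split /= wS add0r sumrN -mulr_sumr sumrB.
    rewrite (bigD1 p.1) //= (bigD1 (P := xpredT) p.2) //= !eqxx !big1 ?addr0 ?subrr ?mulr0 ?oppr0 //.
      by move=> i /negPf->.
    by move=> i /negPf->.
have wmin p : qform (invmx L) w <= qform (invmx L) (w - k%:R *: edge_vec p).
  move: wB; rewrite /better; case: pickP => // /(_ p) /negbT; by rewrite -leNgt.
pose phi : 'cV_n.+1 := invmx L *m w^T.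
have Lphi : L *m phi = w^T by rewrite mulmxA mulmxV // mul1mx.
(* Ohm's law: the current on a pair, recorded only in the direction of increasing index. *)
pose A (i j : 'I_n.+1) : rat := if (i < j)%N && (0 < m i j)%N then c (i, j) * (phi i 0 - phi j 0) else 0.
have LphiE u : w 0 u = (u == 0)%:R * phi 0 0 + \sum_v (A u v - A v u).
  have -> : w 0 u = w^T u 0 by rewrite mxE.
  rewrite -Lphi /L laplacianE big_mkcond; congr (_ + _).
  transitivity (\sum_i \sum_j (A i j * (u == i)%:R - A i j * (u == j)%:R)).
    by rewrite pair_bigA /=; apply: eq_bigr => -[i j] _ /=; rewrite /A; case: ifP => _; ring.
  transitivity (\sum_i \sum_j A i j * (u == i)%:R - \sum_i \sum_j A i j * (u == j)%:R).
    by rewrite -sumrB; apply: eq_bigr => i _; rewrite sumrB.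
  rewrite sumrB; congr (_ - _).
    rewrite (bigD1 u) //= [X in _ + X]big1 ?addr0; first by apply: eq_bigr => j _; rewrite eqxx mulr1.
    by move=> i iu; rewrite big1 // => j _; rewrite eq_sym (negPf iu) mulr0.
  apply: eq_bigr => i _; rewrite (bigD1 u) //= eqxx mulr1 big1 ?addr0 // => j ju.
  by rewrite eq_sym (negPf ju) mulr0.
(* Currents cancel in the sum of all vertex equations and [w] sums to zero, so the grounding term
   vanishes and [w] is exactly the divergence of the currents. *)
have phi0 : phi 0 0 = 0.
  move: wS; under eq_bigr do rewrite LphiE.
  rewrite big_split /= (bigD1 0) //= mul1r big1 ?addr0 => [|i /negPf->]; last by rewrite mul0r.
  move=> <-; rewrite -[LHS]addr0; congr (_ + _).
  under eq_bigr do rewrite sumrB.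
  by rewrite sumrB [X in _ - X]exchange_big /= subrr.
have wE u : w 0 u = \sum_v (A u v - A v u) by rewrite LphiE phi0 mulr0 add0r.
(* With [r] the effective resistance and [f] the potential difference, minimality says that the
   energy change [k ^ 2 r - 2 k f] is nonnegative. *)
have wmin2 p : phi p.1 0 - phi p.2 0 <= k%:R / 2%:R * qform (invmx L) (edge_vec p).
  have := wmin p; rewrite -scaleNr qformD // qformZ sqrrN.
  have -> : (w *m invmx L *m (- k%:R *: edge_vec p)^T) 0 0 = - k%:R * (phi p.1 0 - phi p.2 0).
    rewrite linearZ /= -scalemxAr mxE; congr (_ * _).
    rewrite -mul_edge_vec /phi.
    have -> : edge_vec p *m (invmx L *m w^T) = (w *m invmx L *m (edge_vec p)^T)^T.
      by rewrite !trmx_mul trmxK sL.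
    by rewrite [RHS]mxE.
  move: (qform _ (edge_vec p)) (qform _ w) (phi p.1 0 - phi p.2 0) => r q f.
  have -> : (k%:R / 2%:R * r : rat) = k%:R * r / 2%:R by ring.
  move=> h; rewrite ler_pdivlMr //; rewrite -(ler_pM2l k0); lra.
have edge_vecN i j : qform (invmx L) (edge_vec (i, j)) = qform (invmx L) (edge_vec (j, i)).
  have -> : edge_vec (i, j) = (-1) *: edge_vec (j, i).
    by rewrite scaleN1r /edge_vec opprB.
  by rewrite qformZ sqrrN expr1n mul1r.
(* The current is at most [c_e * k R_e / 2], and [c_e R_e < m_e / (2 k)] makes this less than
   [m_e / 4]. *)
have Alt (i j : 'I_n.+1) : (i < j)%N -> (0 < m i j)%N -> `|A i j| < (m i j)%:R / 4%:R.
  move=> ij mij; rewrite /A ij mij /= normrM gtr0_norm ?(c0 (i, j)) //.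
  have : `|phi i 0 - phi j 0| <= k%:R / 2%:R * qform (invmx L) (edge_vec (i, j)).
    rewrite ler_norml (wmin2 (i, j)) andbT lerNl opprB edge_vecN.
    exact: (wmin2 (j, i)).
  move=> h; have cij := c0 (i, j) mij.
  apply: le_lt_trans (ler_wpM2l (ltW cij) h) _.
  have := cR (i, j) ij mij; rewrite /= natrM.
  move: (qform _ _) (c (i,j)) => r cc; rewrite ltr_pdivlMr; last by rewrite mulr_gt0.
  by rewrite ltr_pdivlMr //; lra.
pose F u v := A u v - A v u.
have A0 (i j : 'I_n.+1) : (j <= i)%N -> A i j = 0 by move=> ij; rewrite /A ltnNge ij.
have A0m (i j : 'I_n.+1) : m i j = 0%N -> A i j = 0 by move=> ij; rewrite /A ij ltnn andbF.
have Flt i j : (0 < m i j)%N -> `|F i j| < (m i j)%:R / 4%:R.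
  move=> mij; rewrite /F; case: (ltngtP i j) => [ij|ji|/val_inj ij].
  - by rewrite (A0 j i (ltnW ij)) subr0 Alt.
  - by rewrite (A0 i j (ltnW ji)) sub0r normrN m_sym Alt // m_sym.
  - by move: mij; rewrite -ij subrr normr0 => mii; rewrite divr_gt0 // ltr0n.
have Fle i j : `|F i j| <= (m i j)%:R / 4%:R.
  have [mij|/Flt/ltW //] := posnP (m i j).
  by rewrite /F !A0m ?(m_sym j i) // subrr normr0 mij mul0r.
exists (fun u => w 0 u), F; split=> //.
- by move=> u v; rewrite /F opprB.
- move=> u; rewrite wE.
  (* The degree bound [4 * k] turns edge bounds of [m_e / 4] into the bound [k]. Strictness comes
     from one incident edge; without any, [w u] is zero. *)
  have degu : \sum_v (m u v)%:R / 4%:R <= k%:R :> rat.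
    rewrite -mulr_suml ler_pdivrMr // -natr_sum -natrM ler_nat mulnC; exact: deg_m.
  case: (pickP (fun v => 0 < m u v)%N) => [v uv|m0].
    apply: le_lt_trans (ler_norm_sum _ _ _) _; apply: lt_le_trans degu.
    rewrite (bigD1 v) //= [ltRHS](bigD1 v) //=; apply: ltr_leD; first exact: Flt.
    by apply: ler_sum => j _; apply: Fle.
  rewrite big1 ?normr0 // => v _; have /negbT := m0 v; rewrite -eqn0Ngt => /eqP mv.
  by rewrite !A0m ?(m_sym v u) // subrr.
Qed.
End LatticeFlow.

(** * Terminal flows for [k = 1], [k = 2] and general [k] *)

Section Terminals.
Variables (I : finType) (m : I -> I -> nat).
Hypothesis lm : loopless_sym m.

Definition terminal_flow (k : nat) (kap : rat) (alpha : I -> rat) : Prop :=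
  exists2 w : I -> rat, routable kap m w &
    forall u, (exists t : int, w u = alpha u + k%:R * t%:~R) /\ `|w u| < k%:R.

Definition orientation (j : I -> I -> nat) := forall u v, (j u v + j v u = m u v)%N.

(** Half a unit is sent along every edge in its direction: the net flow [(j u v - j v u) / 2] equals
    [j u v - m u v / 2]. *)
Lemma orientation_flow j : orientation j ->
  routable 2%:R^-1 m (fun u => (\sum_v j u v)%:R - (mdeg m u)%:R / 2%:R).
Proof.
move=> jm; exists (fun u v => (j u v)%:R - (m u v)%:R / 2%:R); split.
- by move=> u v; rewrite lm.1 -jm natrD; field.
- move=> u v; rewrite -(jm u v) natrD; have := ler0n rat (j u v); have := ler0n rat (j v u).
  by move: (_%:R) (_%:R) => a b a0 b0; rewrite ler_norml; apply/andP; split; lra.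
- by move=> u; rewrite sumrB -mulr_suml -!natr_sum.
Qed.

Lemma orientation_exists : exists j, orientation j.
Proof.
exists (fun u v => if (enum_rank u < enum_rank v)%N then m u v else 0%N) => u v.
case: ltngtP => [_|_|/val_inj/enum_rank_inj ->]; rewrite ?addn0 ?add0n //.
  by rewrite lm.1.
by rewrite lm.2.
Qed.

Lemma orientation_bound j d u : orientation j -> (mdeg m u <= d)%N ->
  `|(\sum_v j u v)%:R - (mdeg m u)%:R / 2%:R : rat| <= d%:R / 2%:R.
Proof.
move=> jm du; have ju : (\sum_v j u v <= mdeg m u)%N.
  by apply: leq_sum => v _; rewrite -(jm u v) leq_addr.
move: ju du; rewrite -!(ler_nat rat); have := ler0n rat (\sum_v j u v).
by move: (_%:R) (_%:R) (_%:R) => a b c *; rewrite ler_norml; apply/andP; split; lra.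
Qed.

Lemma terminal_flow1 (alpha : I -> rat) : (forall u, (mdeg m u <= 1)%N) ->
  (forall u, exists a : int, alpha u = a%:~R - (mdeg m u)%:R / 2%:R) ->
  terminal_flow 1 2%:R^-1 alpha.
Proof.
move=> d1 aP; have [j jm] := orientation_exists.
exists (fun u => (\sum_v j u v)%:R - (mdeg m u)%:R / 2%:R); first exact: orientation_flow.
move=> u; split; last by apply: le_lt_trans (orientation_bound jm (d1 u)) _.
have [a ->] := aP u; exists ((\sum_v j u v)%N%:Z - a).
by rewrite rmorphB /= -pmulrn; ring.
Qed.

(** Reversing one edge between [u] and [v] changes the out-degrees of its two ends by one. At least
    one of the two directions has an edge to reverse. *)
Lemma orientation_toggle j u v : orientation j -> (0 < m u v)%N ->
  exists2 j', orientation j' &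
    forall w, odd (\sum_x j' w x) = odd (\sum_x j w x) (+) (w == u) (+) (w == v).
Proof.
have half j0 u0 v0 : orientation j0 -> (0 < j0 u0 v0)%N ->
  exists2 j', orientation j' &
    forall w, odd (\sum_x j' w x) = odd (\sum_x j0 w x) (+) (w == u0) (+) (w == v0).
  move=> jm ju.
  have uv : u0 != v0.
    by apply: contraTneq ju => <-; have := jm u0 u0; rewrite lm.2; lia.
  pose one (a b x y : I) := ((x == a) && (y == b) : nat).
  pose j' x y := (j0 x y - one u0 v0 x y + one v0 u0 x y)%N.
  have j'E x y : (j' x y + one u0 v0 x y = j0 x y + one v0 u0 x y)%N.
    rewrite /j' addnAC subnK // /one; case: eqP => //= ->; case: eqP => //= ->.
    exact: ju.
  exists j' => [x y|w].
    have := jm x y; have := j'E x y; have := j'E y x; rewrite /one.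
    by rewrite [(y == u0) && _]andbC [(y == v0) && _]andbC; lia.
  have sum1 a b : (\sum_x one a b w x = (w == a))%N.
    rewrite (bigD1 b) //= /one eqxx andbT big1 ?addn0 // => x /negPf->; by rewrite andbF.
  have : (\sum_x j' w x + (w == u0) = \sum_x j0 w x + (w == v0))%N.
    by rewrite -(sum1 u0 v0) -(sum1 v0 u0) -!big_split; apply: eq_bigr => x _; apply: j'E.
  move/(congr1 odd); rewrite !oddD !oddb => /(congr1 (addb (w == u0))).
  by rewrite addbC addbK => ->; rewrite addbCA addbA addbC.
move=> jm muv; have [j0|] := posnP (j u v); last exact: half.
have [|j' j'm j'P] := half j v u jm; first by have := jm u v; lia.
by exists j' => // w; rewrite j'P -!addbA [(w == v) (+) _]addbC.
Qed.

Lemma orientation_toggle_connect j u v : orientation j ->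
  connect (fun x y => 0 < m x y)%N u v ->
  exists2 j', orientation j' &
    forall w, odd (\sum_x j' w x) = odd (\sum_x j w x) (+) (w == u) (+) (w == v).
Proof.
move=> jm /connectP[p]; elim: p u j jm => [|x p IH] u j jm /=.
  by move=> _ ->; exists j => // w; rewrite addbK.
move=> /andP[mux px] vE; have [j1 j1m j1P] := orientation_toggle jm mux.
have [j2 j2m j2P] := IH x j1 j1m px vE.
by exists j2 => // w; rewrite j2P j1P addbK.
Qed.

Lemma connect_of_cuts l r u : (0 < l)%N -> cut_cond m setT l ->
  connect (fun x y => 0 < m x y)%N u r.
Proof.
move=> l0 /forallP cc; pose S := [set x | connect (fun x y => 0 < m x y)%N x r].
have rS : r \in S by rewrite inE connect0.
suff: u \in S by rewrite inE.
apply: contraT => uS; have := cc S.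
have -> : separates S setT.
  by apply/andP; split; apply/existsP; [exists r|exists u]; rewrite ?rS ?uS inE.
rewrite /= (_ : dcut m S = 0%N); first by lia.
rewrite dcutE // big1 ?muln0 // => x xS; rewrite big1 // => y; rewrite inE => yS.
apply/eqP; rewrite -leqn0 leqNgt; apply: contra yS => mxy; move: xS; rewrite !inE.
by apply: connect_trans; apply: connect1; rewrite lm.1.
Qed.

(** Reversals along paths to a root [r] correct the parity at all other vertices one by one; the
    parity at [r] then follows from the prescribed total. Degrees at most 3 bound the divergence by
    [3 / 2 < 2]. *)
Lemma terminal_flow2 (alpha : I -> rat) (z : int) : (forall u, (mdeg m u <= 3)%N) ->
  cut_cond m setT 2 ->
  (forall u, exists a : int, alpha u = a%:~R - (mdeg m u)%:R / 2%:R) ->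
  \sum_u alpha u = 2%:R * z%:~R ->
  terminal_flow 2 2%:R^-1 alpha.
Proof.
move=> d3 cc /fin_all_exists[a aP] sa.
have [j0 j0m] := orientation_exists.
case: (pickP I) => [r _|no]; last first.
  exists (fun _ => 0); last by move=> u; have := no u.
  by exists (fun _ _ => 0); split=> u; have := no u.
have fix_all (s : seq I) : exists2 j, orientation j &
    {in s, forall u, u != r -> odd (\sum_v j u v) = ~~ (2 %| a u)%Z}.
  elim: s => [|u s [j jm js]]; first by exists j0.
  have [ur|ur] := eqVneq u r.
    by exists j => // v; rewrite inE => /predU1P[->|/js //]; rewrite ur eqxx.
  case: (boolP (odd (\sum_v j u v) == ~~ (2 %| a u)%Z)) => [/eqP ok|bad].
    by exists j => // v; rewrite inE => /predU1P[->|/js //].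
  have [j' j'm j'P] := orientation_toggle_connect jm (@connect_of_cuts 2 r u isT cc).
  exists j' => // v; rewrite inE => vs vr; rewrite j'P (negPf vr) addbF.
  have [->|vu] := eqVneq v u; first by move: bad; case: (odd _); case: (_ %| _)%Z.
  by rewrite addbF js //; move: vs; rewrite (negPf vu).
have [j jm jP] := fix_all (enum I).
have jodd u : u != r -> (2 %| (\sum_v j u v)%N%:Z - a u)%Z.
  by move=> ur; have := jP u (mem_enum _ _) ur; move: (\sum_v j u v)%N => o; lia.
have tot : \sum_u ((\sum_v j u v)%N%:Z - a u) = - (2 * z).
  apply: (@intr_inj rat); rewrite rmorph_sum /= rmorphN rmorphM /= -sa.
  have -> : \sum_u alpha u = \sum_u ((a u)%:~R - (mdeg m u)%:R / 2%:R).
    by apply: eq_bigr => u _; rewrite aP.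
  under eq_bigr do rewrite rmorphB /= -pmulrn.
  rewrite !sumrB -mulr_suml -!natr_sum.
  have -> : (\sum_u mdeg m u = 2 * \sum_u \sum_v j u v)%N.
    rewrite mul2n -addnn [X in (_ = X + _)%N]exchange_big -big_split; apply: eq_bigr => u _.
    by rewrite -big_split; apply: eq_bigr => v _; rewrite -(jm u v) addnC.
  by rewrite natrM; field.
have jr u : (2 %| (\sum_v j u v)%N%:Z - a u)%Z.
  have [->|/jodd //] := eqVneq u r.
  move: tot; rewrite (bigD1 r) //= => /(canRL (addrK _)) ->.
  rewrite rpredB ?rpredN ?dvdz_mulr // rpred_sum // => v; exact: jodd.
exists (fun u => (\sum_v j u v)%:R - (mdeg m u)%:R / 2%:R); first exact: orientation_flow.
move=> u; split; last by apply: le_lt_trans (orientation_bound jm (d3 u)) _.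
have /dvdzP[q /(congr1 (fun t : int => t%:~R : rat))] := jr u.
rewrite rmorphB rmorphM /= -pmulrn => qE; exists q; rewrite aP; lra.
Qed.

Lemma terminal_flow3 (k : nat) (alpha : I -> rat) (z : int) : (0 < k)%N ->
  (forall u, (mdeg m u <= 4 * k)%N) -> cut_cond m setT (4 * k) ->
  \sum_u alpha u = k%:R * z%:~R -> terminal_flow k 4%:R^-1 alpha.
Proof.
move=> k0 dk cc sa.
case: (posnP #|I|) => [I0|].
  have no (u : I) : False by have := card0_eq I0 u.
  exists (fun _ => 0); last by move=> u; case: (no u).
  by exists (fun _ _ => 0); split=> u; case: (no u).
case n_I : #|I| => [//|n] _.
pose p (i : 'I_n.+1) : I := enum_val (cast_ord (esym n_I) i).
pose q (u : I) : 'I_n.+1 := cast_ord n_I (enum_rank u).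
have pK : cancel p q by move=> i; rewrite /q /p enum_valK cast_ordKV.
have qK : cancel q p by move=> u; rewrite /q /p cast_ordK enum_rankK.
have p_inj := can_inj pK.
have sum_p (R : nmodType) (f : I -> R) : \sum_i f (p i) = \sum_u f u.
  by rewrite [RHS](reindex p) //; exists q => u _.
pose m' i j := m (p i) (p j).
have [|||S S0 ST||w [F [wP Fa Fb Fs wb]]] := @lattice_flow n k m' (fun i => alpha (p i)) z.
- exact: k0.
- by move=> u v; rewrite /m' lm.1.
- by move=> u; apply: leq_trans (dk (p u)); rewrite /mdeg -(sum_p _ (m (p u))).
- have [i iS] : exists i, i \in S by apply/set0Pn.
  have [j jS] : exists j, j \notin S.
    by apply/existsP; rewrite -negb_forall; apply: contra ST => /forallP h; apply/eqP/setP => j; rewrite h inE.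
  have := forallP cc (p @: S).
  have -> : separates (p @: S) setT.
    by apply/andP; split; apply/existsP; [exists (p i)|exists (p j)]; rewrite in_setT (mem_imset _ _ p_inj).
  rewrite /= dcutE // leq_mul2l /= => /leq_trans; apply.
  rewrite big_imset /=; last by move=> ? ? _ _; apply: p_inj.
  have -> : ~: (p @: S) = p @: (~: S).
    by apply/setP=> v; rewrite -(qK v) inE !(mem_imset _ _ p_inj) inE.
  by apply: leq_sum => u uS; rewrite big_imset //= => ? ? _ _; apply: p_inj.
- by rewrite sum_p sa.
exists (fun u => w (q u)).
  exists (fun u v => F (q u) (q v)); split=> [u v|u v|u].
  - exact: Fa.
  - by rewrite mulrC; apply: le_trans (Fb _ _) _; rewrite /m' !qK.
  - by rewrite -sum_p; under eq_bigr do rewrite pK; rewrite Fs.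
move=> u; split; last exact: wb.
by have := wP (q u); rewrite qK.
Qed.
End Terminals.

(** * Rounding bipartite fractional factors *)

Lemma underdetermined_kernel (E : finType) (C : eqType) (cs : seq C) (a : C -> E -> rat) :
  (size cs < #|E|)%N ->
  exists2 z : E -> rat, (exists e, z e != 0) & {in cs, forall c, \sum_e a c e * z e = 0}.
Proof.
move=> lt; case: cs lt => [|c0 cs'] lt.
  exists (fun _ => 1) => //; have /card_gt0P[e _] : (0 < #|E|)%N by [].
  by exists e; rewrite oner_eq0.
set cs := c0 :: cs' in lt *.
pose M : 'M[rat]_(#|E|, size cs) := \matrix_(i, j) a (nth c0 cs j) (enum_val i).
have : kermx M != 0.
  rewrite -mxrank_eq0 mxrank_ker subn_eq0 -ltnNge.
  exact: leq_ltn_trans (rank_leq_col M) lt.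
case/rowV0Pn => v /sub_kermxP vM v0.
have [j vj] : exists j, v 0 j != 0.
  apply/existsP; rewrite -negb_forall; apply: contraNN v0 => /forallP v0.
  by apply/eqP/rowP => j; rewrite mxE; apply/eqP; exact: v0.
exists (fun e => v 0 (enum_rank e)); first by exists (enum_val j); rewrite enum_valK.
move=> c /(nthP c0)[i ilt <-].
have /matrixP/(_ 0 (Ordinal ilt)) := vM; rewrite !mxE => {2}<-.
rewrite (reindex_onto (fun j : 'I_#|E| => enum_val j) enum_rank) => [|e _]; last exact: enum_rankK.
apply: eq_big => [e|e _]; first by rewrite enum_valK eqxx.
by rewrite enum_valK mxE mulrC.
Qed.

Section Rounding.
Variables (E V1 V2 : finType) (x : E -> V1) (y : E -> V2).

Let fractional (h : E -> rat) := [set e | (h e != 0) && (h e != 1)].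

(** An integral sum cannot contain exactly one fractional term, so every vertex met by a fractional
    edge is met by at least two. *)
Lemma fractional_ends (V : finType) (p : E -> V) (h : E -> rat) :
  (forall e, 0 <= h e <= 1) -> (forall v, \sum_(e | p e == v) h e \is a Num.int) ->
  (2 * #|p @: fractional h| <= #|fractional h|)%N.
Proof.
move=> h01 hint; rewrite mulnC -sum_nat_const -[leqRHS]sum1_card.
rewrite (partition_big_imset p) /=; apply: leq_sum => v /imsetP[e eF ve].
rewrite (bigD1 e) /=; last by rewrite eF ve eqxx.
rewrite add1n ltnS sum1_card; apply/card_gt0P.
have/existsP[f fP] : [exists f, [&& f \in fractional h, p f == v & f != e]].
  apply: contraT; rewrite negb_exists => /forallP no.
  have := hint v; rewrite (bigD1 e) ?ve //= -ve.
  have oint : \sum_(f | (p f == v) && (f != e)) h f \is a Num.int.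
    apply: rpred_sum => f /andP[fv fe]; have := no f; rewrite fv fe !andbT inE negb_and !negbK.
    by case/orP=> /eqP->; rewrite ?rpred0 ?rpred1.
  rewrite rpredDr // => /intrP[t ht].
  move: eF (h01 e); rewrite inE ht => /andP[].
  rewrite -[1]/(1%:~R) -[0]/(0%:~R) !eqr_int !ler_int; lia.
by exists f; case/and3P: fP => fF fv fe; rewrite unfold_in; apply/andP; split=> //; apply/andP.
Qed.

(** A dimension count in place of a search for cycles. There are at most [|Fr| / 2] constraints on
    each side and one for every integral edge, which only allows [|E|]; one vertex constraint is
    dropped, being implied by the others. *)
Lemma fractional_kernel (h : E -> rat) :
  (forall e, 0 <= h e <= 1) ->
  (forall v, \sum_(e | x e == v) h e \is a Num.int) ->
  (forall v, \sum_(e | y e == v) h e \is a Num.int) ->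
  (0 < #|fractional h|)%N ->
  exists z : E -> rat, [/\ exists e, z e != 0, forall e, e \notin fractional h -> z e = 0,
    forall v, \sum_(e | x e == v) z e = 0 & forall v, \sum_(e | y e == v) z e = 0].
Proof.
move=> h01 hx hy /card_gt0P[e0 e0F]; set Fr := fractional h in e0F *.
pose a (c : V1 + V2 + E) (e : E) : rat := match c with
  | inl (inl v) => (x e == v)%:R | inl (inr v) => (y e == v)%:R | inr f => (e == f)%:R end.
pose cs : seq (V1 + V2 + E) := [seq inl (inl v) | v <- enum (x @: Fr)] ++
  [seq inl (inr v) | v <- enum ((y @: Fr) :\ y e0)] ++ [seq inr f | f <- enum (~: Fr)].
have cs_lt : (size cs < #|E|)%N.
  rewrite !size_cat !size_map -!cardE.
  have := fractional_ends h01 hx; have := fractional_ends h01 hy; rewrite -/Fr.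
  have := cardsD1 (y e0) (y @: Fr); rewrite imset_f // => ->.
  by have := cardsC Fr; lia.
have [z z0 zP] := underdetermined_kernel a cs_lt.
have sumE (b : E -> bool) : \sum_e (b e)%:R * z e = \sum_(e | b e) z e.
  by rewrite [RHS]big_mkcond; apply: eq_bigr => e _; case: (b e); rewrite ?mul1r ?mul0r.
have zF e : e \notin Fr -> z e = 0.
  move=> eF; have := zP (inr e); rewrite /= sumE big_pred1_eq; apply.
  by rewrite !mem_cat (map_f inr) ?mem_enum ?inE ?orbT // -/Fr; move: eF; rewrite inE.
have zx v : \sum_(e | x e == v) z e = 0.
  case: (boolP (v \in x @: Fr)) => [vF|vF].
    by have := zP (inl (inl v)); rewrite /= sumE; apply; rewrite mem_cat map_f // mem_enum.
  rewrite big1 // => e /eqP ev; apply: zF; apply: contra vF => eF.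
  by rewrite -ev imset_f.
have zy' v : v != y e0 -> \sum_(e | y e == v) z e = 0.
  move=> vy0; case: (boolP (v \in y @: Fr)) => [vF|vF].
    have := zP (inl (inr v)); rewrite /= sumE; apply.
    by rewrite !mem_cat (map_f (inl \o inr)) ?orbT // mem_enum !inE vy0.
  rewrite big1 // => e /eqP ev; apply: zF; apply: contra vF => eF.
  by rewrite -ev imset_f.
exists z; split=> // v; have [->|/zy' //] := eqVneq v (y e0).
(* The constraints on either side add up to the total of [z], so those for [x] and the remaining
   ones for [y] imply the omitted one at [y e0]. *)
have tot : \sum_e z e = 0.
  by rewrite (partition_big x xpredT) //= big1.
move: tot; rewrite (partition_big y xpredT) //= (bigD1 (y e0)) //= [X in _ + X]big1 ?addr0 //.
Qed.

(** Moving from [h] in the kernel direction [z], the value [r e] is the step length at which [e]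
    reaches 0 or 1. The smallest such length makes one more edge integral and keeps all values in
    range. *)
Lemma round_step (h : E -> rat) :
  (forall e, 0 <= h e <= 1) ->
  (forall v, \sum_(e | x e == v) h e \is a Num.int) ->
  (forall v, \sum_(e | y e == v) h e \is a Num.int) ->
  (0 < #|fractional h|)%N ->
  exists h' : E -> rat, [/\ forall e, 0 <= h' e <= 1,
    forall v, \sum_(e | x e == v) h' e = \sum_(e | x e == v) h e,
    forall v, \sum_(e | y e == v) h' e = \sum_(e | y e == v) h e,
    forall e, e \notin fractional h -> h' e = h e &
    (#|fractional h'| < #|fractional h|)%N].
Proof.
move=> h01 hx hy F0; have [z [[e1 ze1] zF zx zy]] := fractional_kernel h01 hx hy F0.
pose r e := if 0 < z e then (1 - h e) / z e else h e / - z e.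
case: (@Order.TotalTheory.arg_minP _ _ _ e1 (fun e => z e != 0) r ze1) => f zf fmin.
pose h' e := h e + r f * z e.
have rf0 : 0 <= r f.
  have /andP[h0 h1] := h01 f; rewrite /r; case: ltP => zf0.
    by rewrite divr_ge0 ?subr_ge0 // ltW.
  by rewrite divr_ge0 // oppr_ge0.
have hF e : e \notin fractional h -> h' e = h e by move=> /zF ze; rewrite /h' ze mulr0 addr0.
have h'01 e : 0 <= h' e <= 1.
  have [ze|ze] := eqVneq (z e) 0; first by rewrite /h' ze mulr0 addr0.
  have /andP[h0 h1] := h01 e; have := fmin e ze; rewrite /h' {2}/r.
  case: ltP => ze0.
    rewrite ler_pdivlMr // => le; apply/andP; split; last by lra.
    by rewrite addr_ge0 // mulr_ge0 // ltW.
  have zn : 0 < - z e by rewrite oppr_gt0 lt_neqAle ze ze0.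
  rewrite ler_pdivlMr // mulrN => le; apply/andP; split; first by lra.
  have : 0 <= r f * - z e by rewrite mulr_ge0 // ltW.
  by rewrite mulrN; lra.
exists h'; split=> //.
- by move=> v; rewrite big_split /= -mulr_sumr zx mulr0 addr0.
- by move=> v; rewrite big_split /= -mulr_sumr zy mulr0 addr0.
have fF : f \in fractional h by apply: contraR zf => /zF->.
apply: proper_card; apply/properP; split.
  apply/subsetP => e; apply: contraTT => eF; move: (eF); rewrite inE negb_and !negbK => h0.
  by rewrite inE negb_and !negbK hF.
exists f => //; rewrite inE negb_and !negbK /h' /r; case: ltP => zf0.
  by rewrite divfK // addrC subrK eqxx orbT.
have zn : - z f != 0 by rewrite oppr_eq0.
by rewrite -[_ / _ * _]opprK -mulrN divfK // subrr eqxx.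
Qed.

Lemma bipartite_rounding (h : E -> rat) :
  (forall e, 0 <= h e <= 1) ->
  (forall v, \sum_(e | x e == v) h e \is a Num.int) ->
  (forall v, \sum_(e | y e == v) h e \is a Num.int) ->
  exists H : {set E}, [/\ forall e, h e = 1 -> e \in H, forall e, h e = 0 -> e \notin H,
    forall v, #|[set e in H | x e == v]|%:R = \sum_(e | x e == v) h e &
    forall v, #|[set e in H | y e == v]|%:R = \sum_(e | y e == v) h e].
Proof.
have [d] := ubnP #|fractional h|; elim: d h => // d IH h dlt h01 hx hy.
have [F0|F0] := posnP #|fractional h|; last first.
  have [h' [h'01 h'x h'y h'F lt]] := round_step h01 hx hy F0.
  have [||||H [H1 H0 Hx Hy]] := IH h'.
  - exact: leq_trans lt _.
  - exact: h'01.
  - by move=> v; rewrite h'x.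
  - by move=> v; rewrite h'y.
  exists H; split=> [e he|e he|v|v]; rewrite -?h'x -?h'y //.
  - by apply: H1; rewrite h'F ?he // inE he eqxx andbF.
  - by apply: H0; rewrite h'F ?he // inE he eqxx.
have hE e : h e = (h e == 1)%:R.
  have : e \notin fractional h by rewrite (eqP (introT eqP (cards0_eq F0))) inE.
  by rewrite inE negb_and !negbK => /orP[/eqP->|/eqP->]; rewrite ?eqxx // eq_sym oner_eq0.
have cnt (V : finType) (p : E -> V) v :
    #|[set e in [set e | h e == 1] | p e == v]|%:R = \sum_(e | p e == v) h e.
  rewrite -sum1_card natr_sum [LHS]big_mkcond [RHS]big_mkcond; apply: eq_bigr => e _ /=.
  rewrite !inE andbC; case: (p e == v) => //=; rewrite [RHS]hE.
  by case: (h e == 1).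
exists [set e | h e == 1]; split=> //.
- by move=> e he; rewrite inE he.
- by move=> e he; rewrite inE he eq_sym oner_eq0.
Qed.
End Rounding.

(** * Flows in bipartite multigraphs *)

Lemma big_sig_val (R : nmodType) (V : finType) (Y : {set V}) (f : V -> R) :
  \sum_(i : {v | v \in Y}) f (val i) = \sum_(v in Y) f v.
Proof.
rewrite [RHS](reindex_omap (val : {v | v \in Y} -> V) insub) => [|v vY].
  by apply: eq_bigl => i; rewrite valK eqxx (valP i).
by case: insubP => [i _ <-|]; rewrite ?vY.
Qed.

Section HubFlow.
Variables (E V : finType) (xe ye : E -> V) (X Y : {set V}) (T : {set E}).
Hypotheses (xX : forall e, xe e \in X) (yY : forall e, ye e \in Y)
  (XY : [disjoint X & Y]) (XYT : X :|: Y = setT).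

Let xY e : xe e \notin Y. Proof. by rewrite (disjointFr XY). Qed.
Let yX e : ye e \notin X. Proof. by rewrite (disjointFl XY). Qed.

Definition mult (u v : V) : nat := (\sum_(e in T) edge1 (xe e) (ye e) u v)%N.

Lemma mult_sym u v : mult u v = mult v u.
Proof. by apply: eq_bigr => e _; rewrite edge1C. Qed.

Lemma multE u v : v \in Y -> mult u v = #|[set e in T | (ye e == v) && (xe e == u)]|.
Proof.
move=> vY; rewrite /mult -sum1_card big_mkcond [RHS]big_mkcond; apply: eq_bigr => e _ /=.
rewrite inE /edge1; case: (e \in T) => //=.
have /negPf-> : v != xe e by apply: contraTneq vY => ->.
rewrite andbF addn0 andbC (eq_sym v) (eq_sym u); by case: (_ && _).
Qed.

Lemma multEr u v : v \in X -> mult u v = #|[set e in T | (xe e == v) && (ye e == u)]|.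
Proof.
move=> vX; rewrite /mult -sum1_card big_mkcond [RHS]big_mkcond; apply: eq_bigr => e _ /=.
rewrite inE /edge1; case: (e \in T) => //=.
have /negPf-> : v != ye e by apply: contraTneq vX => ->.
rewrite andbF add0n andbC (eq_sym v) (eq_sym u); by case: (_ && _).
Qed.

Lemma mult_loopless u : mult u u = 0%N.
Proof.
apply: big1 => e _; rewrite /edge1.
case: (eqVneq u (xe e)) => [->|] //=; rewrite ?andbF //.
have /negPf-> : xe e != ye e by apply: contraTneq (yY e) => <-.
by [].
Qed.

Lemma sum_mult u : (\sum_v mult u v =
  #|[set e in T | xe e == u]| + #|[set e in T | ye e == u]|)%N.
Proof.
rewrite exchange_big /=; under eq_bigr do rewrite sum_edge1.
rewrite big_split /=; congr (_ + _)%N; rewrite -sum1_card [RHS]big_mkcond [LHS]big_mkcond /=;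
  by apply: eq_bigr => e _; rewrite inE eq_sym; case: (e \in T) => //=; case: (_ == _).
Qed.

Lemma dcut_mult S :
  dcut mult S = (2 * #|[set e in T | (xe e \in S) (+) (ye e \in S)]|)%N.
Proof.
transitivity (\sum_(e in T) dcut (edge1 (xe e) (ye e)) S)%N.
  rewrite /dcut [RHS]exchange_big /=; apply: eq_bigr => u _; rewrite [RHS]exchange_big /=.
  by apply: eq_bigr => v _; rewrite big_distrl.
under eq_bigr do rewrite dcut_edge1.
rewrite -big_distrr /= -sum1_card; congr (2 * _)%N; rewrite [RHS]big_mkcond [LHS]big_mkcond /=.
by apply: eq_bigr => e _; rewrite inE; case: (e \in T) => //=; case: (_ (+) _).
Qed.

Local Notation I := {v : V | v \in Y}.

(** Every edge of [T] is taken [c] times, and each [v] in [Y] gets its own terminal [inr v], joined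
    to it by [port v] parallel edges. *)
Definition hub_mult (c : nat) (port : V -> nat) (a b : V + I) : nat :=
  match a, b with
  | inl u, inl v => c * mult u v
  | inl u, inr i => (u == val i) * port (val i)
  | inr i, inl u => (u == val i) * port (val i)
  | inr _, inr _ => 0
  end.

Lemma hub_mult_loopless c port : loopless_sym (hub_mult c port).
Proof.
split=> [[u|i] [v|j]|[u|i]] //=; first by rewrite mult_sym.
by rewrite mult_loopless muln0.
Qed.

Lemma mdeg_hub c port u : (mdeg (hub_mult c port) (inl u) =
  c * (#|[set e in T | xe e == u]| + #|[set e in T | ye e == u]|) + (u \in Y) * port u)%N.
Proof.
rewrite /mdeg big_sumType /= -big_distrr /= sum_mult; congr (_ + _)%N.
rewrite (big_sig_val Y (fun v => (u == v) * port v)%N) big_mkcond (bigD1 u) //= eqxx mul1n.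
rewrite big1 ?addr0 => [|v vu]; last by rewrite eq_sym (negPf vu); case: (v \in Y).
by case: (u \in Y); rewrite ?mul1n.
Qed.

Lemma mdeg_terminal c port i : mdeg (hub_mult c port) (inr i) = port (val i).
Proof.
rewrite /mdeg big_sumType /= [X in (_ + X)%N]big1 // addn0 (bigD1 (val i)) //= eqxx mul1n.
by rewrite big1 ?addn0 // => v /negPf->.
Qed.

Variables (k c l : nat) (kap : rat) (port : V -> nat) (alpha : V -> rat).
Hypotheses (l_cond : l = 0%N \/ (1 < l)%N)
  (ev_x : {in X, forall x, ~~ odd (c * #|[set e in T | xe e == x]|)})
  (ev_y : {in Y, forall y, ~~ odd (c * #|[set e in T | ye e == y]| + port y)})
  (port_l : {in Y, forall y, l <= port y}%N)
  (cut_l : forall S : {set V}, S != set0 -> S != setT ->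
     (l <= c * #|[set e in T | (xe e \in S) (+) (ye e \in S)]|)%N)
  (kap0 : 0 <= kap) (kap_c : kap * c%:R = 2%:R^-1).

(** A set that splits some terminal from its vertex cuts the whole bundle, of at least [l] edges;
    any other set induces a proper cut of [T]. *)
Lemma hub_cut_cond : cut_cond (hub_mult c port) setT l.
Proof.
apply/forallP => S; apply/implyP => /andP[/existsP[a /andP[_ aS]] /existsP[b /andP[_ bS]]].
have dE : (dcut (hub_mult c port) S = c * dcut mult (inl @^-1: S) +
    2 * \sum_(i : I) ((inl (val i) \in S) (+) (inr i \in S)) * port (val i))%N.
  rewrite /dcut big_sumType /= mul2n -addnn addnA; congr (_ + _)%N.
    under eq_bigr do rewrite big_sumType /=.
    rewrite big_split /= big_distrr /=; congr (_ + _)%N.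
      apply: eq_bigr => u _; rewrite big_distrr /=; apply: eq_bigr => v _.
      by rewrite !inE mulnA.
    rewrite exchange_big; apply: eq_bigr => i _; rewrite (bigD1 (val i)) //= eqxx mul1n mulnC.
    by rewrite big1 ?addn0 // => v /negPf->.
  apply: eq_bigr => i _; rewrite big_sumType /= [X in (_ + X)%N]big1 // addn0.
  rewrite (bigD1 (val i)) //= eqxx mul1n mulnC addbC big1 ?addn0 // => v /negPf->.
  by [].
rewrite dE.
case: (pickP (fun i : I => (inl (val i) \in S) (+) (inr i \in S))) => [i iS|agree].
  apply: leq_trans (leq_addl _ _); rewrite leq_mul2l /= (bigD1 i) //= iS mul1n.
  by apply: leq_trans (leq_addr _ _); apply: port_l; apply: valP.
have agr (i : I) : (inr i \in S) = (inl (val i) \in S).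
  by have := agree i; case: (inl _ \in S); case: (inr i \in S).
apply: leq_trans (leq_addr _ _); rewrite dcut_mult mulnCA leq_mul2l /=; apply: cut_l.
  apply/set0Pn; case: a aS => [u uS|i]; first by exists u; rewrite inE.
  by rewrite agr => iS; exists (val i); rewrite inE.
apply/eqP => ST; case: b bS => [u|i]; rewrite ?agr.
  by have := in_setT u; rewrite -ST inE => ->.
by have := in_setT (val i); rewrite -ST inE => ->.
Qed.

Hypothesis terminals : forall Q : I -> I -> nat, loopless_sym Q ->
  (forall i, (mdeg Q i <= port (val i))%N) ->
  (forall i, odd (mdeg Q i) = odd (port (val i))) -> cut_cond Q setT l ->
  terminal_flow Q k kap (fun i => alpha (val i)).

(** All original vertices are split off, [terminals] provides a flow between terminals, and it is
    lifted back. Conservation at [y] in [Y] passes the amount injected by its terminal on to the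
    edges of [T]. *)
Lemma hub_flow : exists g w, [/\ forall e, `|g e| <= 2%:R^-1,
  {in X, forall x, \sum_(e in T | xe e == x) g e = 0},
  {in Y, forall y, \sum_(e in T | ye e == y) g e = w y},
  {in Y, forall y, exists t : int, w y = alpha y + k%:R * t%:~R} &
  {in Y, forall y, `|w y| < k%:R} : Prop].
Proof.
pose m := hub_mult c port.
have lm : loopless_sym m := hub_mult_loopless c port.
pose H : seq (V + I) := [seq inl v | v <- enum V].
pose W : {set V + I} := [set inr i | i : I].
have HE a : (a \in H) = (if a is inl _ then true else false).
  case: a => [u|i]; first by rewrite map_f ?mem_enum.
  by apply/negbTE/mapP => -[].
have WE a : (a \in W) = (if a is inl _ then false else true).
  case: a => [u|i]; last by rewrite imset_f.
  by apply/negbTE/imsetP => -[].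
have HW a : a \in W :|: [set x in H] by rewrite in_setU in_set HE WE; case: a.
have HWT : W :|: [set x in H] = setT by apply/setP => a; rewrite HW inE.
have [|||||m' [[lm' dle dodd lift] d0 cc']] := @split_hubs _ H m W l l_cond lm.
- by rewrite map_inj_uniq ?enum_uniq // => ? ? [].
- move=> a; rewrite HE; case: a => // u _; rewrite mdeg_hub.
  have [uX|uX] := boolP (u \in X).
    rewrite (disjointFr XY uX) mul0n addn0 (_ : [set e in T | ye e == u] = set0) ?cards0 ?addn0 ?ev_x //.
    apply/setP => e; rewrite !inE; apply/negbTE; rewrite negb_and orbC.
    by have -> : ye e != u by apply: contraTneq uX => <-.
  have uY : u \in Y by have := in_setT u; rewrite -XYT inE (negPf uX).
  rewrite uY mul1n (_ : [set e in T | xe e == u] = set0) ?cards0 ?add0n ?ev_y //.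
  apply/setP => e; rewrite !inE; apply/negbTE; rewrite negb_and orbC.
  by have -> : xe e != u by apply: contraTneq uY => <-.
- by move=> a; rewrite HE WE; case: a.
- by move=> a _; apply: HW.
- by rewrite HWT; apply: hub_cut_cond.
have m'0 u a : m' (inl u) a = 0%N.
  have := d0 (inl u); rewrite HE => /(_ isT)/eqP; rewrite sum_nat_eq0 => /forallP/(_ a)/eqP.
  exact.
have m'0r a u : m' a (inl u) = 0%N by rewrite lm'.1.
pose Q (i j : I) := m' (inr i) (inr j).
have QE i : mdeg Q i = mdeg m' (inr i).
  by rewrite /mdeg [RHS]big_sumType /= [X in _ = (X + _)%N]big1 ?add0n.
have [||||w [F [Fa Fb Fs]] wP] := terminals (Q := Q).
- by split=> [i j|i]; [apply: lm'.1|apply: lm'.2].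
- by move=> i; rewrite QE; apply: leq_trans (dle _) _; rewrite mdeg_terminal.
- by move=> i; rewrite QE dodd mdeg_terminal.
- apply/forallP => S; apply/implyP => /andP[/existsP[i /andP[_ iS]] /existsP[j /andP[_ jS]]].
  have := forallP cc' (inr @: S).
  have inr_inj : injective (inr : I -> V + I) by move=> ? ? [].
  have -> : separates (inr @: S) W.
    apply/andP; split; apply/existsP; [exists (inr i)|exists (inr j)];
      by rewrite WE (mem_imset _ _ inr_inj).
  rewrite /= /dcut big_sumType /= big1 ?add0n; last first.
    by move=> u _; rewrite big1 // => a _; rewrite m'0.
  move=> /leq_trans; apply; rewrite leq_eqVlt; apply/orP; left; apply/eqP.
  apply: eq_bigr => u _; rewrite big_sumType /= big1 ?add0n => [|v _]; last by rewrite m'0r.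
  by apply: eq_bigr => v _; rewrite !(mem_imset _ _ inr_inj).
pose wt (a : V + I) := if a is inr i then w i else 0.
have : routable kap m' wt.
  exists (fun a b => match a, b with inr i, inr j => F i j | _, _ => 0 end); split.
  - by case=> [u|i] [v|j]; rewrite ?oppr0.
  - by case=> [u|i] [v|j]; rewrite ?normr0 ?mulr_ge0.
  - case=> [u|i]; rewrite big_sumType /=; first by rewrite !big1 ?addr0.
    by rewrite big1 ?add0r.
case/(lift _ _ kap0) => G [Ga Gb Gs].
have G0 a b : m a b = 0%N -> G a b = 0.
  by move=> mab; apply/eqP; rewrite -normr_le0; have := Gb a b; rewrite mab mulr0.
(* The flow from [Y] to [X] on a bundle is shared equally by its parallel edges; each gets at most
   [kap * c = 1 / 2]. *)
pose g e := G (inl (ye e)) (inl (xe e)) / (mult (xe e) (ye e))%:R.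
have Gle u v : `|G (inl u) (inl v)| <= (mult u v)%:R / 2%:R.
  apply: le_trans (Gb _ _) _; rewrite /= natrM mulrA kap_c mulrC; exact: lexx.
exists g, (fun v => if insub v is Some i then w i else 0); split.
- move=> e; rewrite /g normrM normfV normr_nat.
  have [->|mp] := posnP (mult (xe e) (ye e)); first by rewrite invr0 mulr0 invr_ge0.
  by rewrite ler_pdivrMr ?ltr0n // mulrC mult_sym; apply: Gle.
- move=> x xX'.
  rewrite (partition_big ye xpredT) //=.
  transitivity (\sum_u G (inl u) (inl x)).
    apply: eq_bigr => u _.
    rewrite (eq_bigr (fun e => G (inl u) (inl x) / (mult x u)%:R)); last first.
      by move=> e /andP[/andP[_ /eqP<-] /eqP<-].
    rewrite sumr_const.
    have -> : #|[pred e | (e \in T) && (xe e == x) && (ye e == u)]| = mult x u.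
      by rewrite mult_sym multEr //; apply: eq_card => e; rewrite !inE andbA.
    have [m0|mp] := posnP (mult x u); last by rewrite -[LHS]mulr_natr divfK // pnatr_eq0 -lt0n.
    by rewrite m0 mulr0n G0 //= mult_sym m0 muln0.
  have := Gs (inl x); rewrite big_sumType /= [X in _ + X]big1 ?addr0 => [h|i _].
    by apply: oppr_inj; rewrite oppr0 -{2}h -sumrN; apply: eq_bigr => u _; rewrite -Ga.
  apply: G0 => /=; have /negPf-> : x != val i; last by rewrite mul0n.
  by apply: contraTneq xX' => ->; rewrite (disjointFl XY) // (valP i).
- move=> y yY'.
  rewrite (partition_big xe xpredT) //=.
  transitivity (\sum_u G (inl y) (inl u)).
    apply: eq_bigr => u _.
    rewrite (eq_bigr (fun e => G (inl y) (inl u) / (mult u y)%:R)); last first.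
      by move=> e /andP[/andP[_ /eqP<-] /eqP<-].
    rewrite sumr_const.
    have -> : #|[pred e | (e \in T) && (ye e == y) && (xe e == u)]| = mult u y.
      by rewrite multE //; apply: eq_card => e; rewrite !inE andbA.
    have [m0|mp] := posnP (mult u y); last by rewrite -[LHS]mulr_natr divfK // pnatr_eq0 -lt0n.
    by rewrite m0 mulr0n G0 //= mult_sym m0 muln0.
  rewrite insubT /=; set i : I := Sub y yY'.
  have := Gs (inr i); rewrite big_sumType /= [X in _ + X]big1 ?addr0 => [|j _]; last exact: G0.
  rewrite (bigD1 y) //= big1 ?addr0 => [<-|v vy]; last by apply: G0 => /=; rewrite (negPf vy).
  have := Gs (inl y); rewrite big_sumType /= [X in _ + X](bigD1 i) //= [X in _ + (_ + X)]big1 ?addr0.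
    by rewrite (Ga (inl y) (inr i)) => /eqP; rewrite addr_eq0 => /eqP.
  move=> j ji; apply: G0 => /=; have /negPf-> : y != val j; last by rewrite mul0n.
  by apply: contraNneq ji => yj; apply/eqP/val_inj.
- by move=> y yY'; rewrite insubT /=; have [] := wP (Sub y yY').
- by move=> y yY'; rewrite insubT /=; have [] := wP (Sub y yY').
Qed.
End HubFlow.

Lemma same_parity_half (a : int) (d d' : nat) : odd d = odd d' ->
  exists a' : int, a%:~R - d%:R / 2%:R = a'%:~R - d'%:R / 2%:R :> rat.
Proof.
move=> dd'; exists (a - d./2%:Z + d'./2%:Z).
rewrite -{1}(odd_double_half d) -{2}(odd_double_half d') dd' !natrD -!mul2n !natrM.
by rewrite rmorphD rmorphB /= -!pmulrn; field.
Qed.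

(** The parameters of [hub_flow] depend on [k]. For [k = 1] and [k = 2] the ports have size 0 or 1,
    respectively 2 or 3, chosen to make degrees in [Y] even. For [k >= 3] doubling makes all degrees
    even, and [2 (3 k - 3) >= 4 k] holds exactly in this range. *)
Lemma bipartite_flow (E V : finType) (xe ye : E -> V) (X Y : {set V}) (T : {set E})
    (k : nat) (alpha : V -> rat) (z : int) :
  (forall e, xe e \in X) -> (forall e, ye e \in Y) -> [disjoint X & Y] -> X :|: Y = setT ->
  (0 < k)%N ->
  {in X, forall x, ~~ odd #|[set e in T | xe e == x]|} ->
  (forall S : {set V}, S != set0 -> S != setT ->
     (3 * k - 3 <= #|[set e in T | (xe e \in S) (+) (ye e \in S)]|)%N) ->
  {in Y, forall y, exists a : int, alpha y = a%:~R - #|[set e in T | ye e == y]|%:R / 2%:R} ->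
  \sum_(y in Y) alpha y = k%:R * z%:~R ->
  exists g w, [/\ forall e, `|g e| <= 2%:R^-1,
    {in X, forall x, \sum_(e in T | xe e == x) g e = 0},
    {in Y, forall y, \sum_(e in T | ye e == y) g e = w y},
    {in Y, forall y, exists t : int, w y = alpha y + k%:R * t%:~R} &
    {in Y, forall y, `|w y| < k%:R} : Prop].
Proof.
move=> xX yY XY XYT k0 ev cut aP sa.
have aQ (i : {v | v \in Y}) (d : nat) : odd d = odd #|[set e in T | ye e == val i]| ->
    exists a : int, alpha (val i) = a%:~R - d%:R / 2%:R.
  move=> di; have [a ->] := aP _ (valP i).
  by have [a' E'] := same_parity_half a (esym di); exists a'.
have sa' : \sum_(i : {v | v \in Y}) alpha (val i) = k%:R * z%:~R by rewrite big_sig_val.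
have [k1|[k2|k3]] : k = 1%N \/ k = 2%N \/ (3 <= k)%N by lia.
- apply: (@hub_flow _ _ xe ye X Y T xX yY XY XYT k 1 0 2%:R^-1
    (fun v => odd #|[set e in T | ye e == v]| : nat)) => //.
  + by left.
  + by move=> x /ev; rewrite mul1n.
  + by move=> y _; rewrite mul1n oddD oddb addbb.
  + move=> Q lQ Qle Qodd _; rewrite k1; apply: terminal_flow1 => // [i|i].
      by apply: leq_trans (Qle i) _; case: odd.
    by apply: aQ; rewrite Qodd oddb.
- apply: (@hub_flow _ _ xe ye X Y T xX yY XY XYT k 1 2 2%:R^-1
    (fun v => 2 + odd #|[set e in T | ye e == v]|)%N) => //.
  + by right.
  + by move=> x /ev; rewrite mul1n.
  + by move=> y _; rewrite mul1n !oddD oddb /= addbb.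
  + by move=> S S0 ST; have := cut S S0 ST; rewrite k2 mul1n; apply: leq_trans.
  + move=> Q lQ Qle Qodd Qc; rewrite k2; apply: (@terminal_flow2 _ _ lQ _ z) => // [i|i|].
    * by apply: leq_trans (Qle i) _; case: odd.
    * by apply: aQ; rewrite Qodd oddD oddb.
    * by rewrite sa' k2.
- apply: (@hub_flow _ _ xe ye X Y T xX yY XY XYT k 2 (4 * k) 4%:R^-1 (fun v => 4 * k)%N) => //.
  + by right; lia.
  + by move=> x _; rewrite mul2n odd_double.
  + by move=> y _; rewrite mul2n oddD odd_double oddM.
  + by move=> S S0 ST; have := cut S S0 ST; lia.
  + move=> Q lQ Qle _ Qc; exact: (@terminal_flow3 _ _ lQ k _ z).
Qed.

(** * From the flow to the factor *)

Lemma subset_of_card (E : finType) (A : {set E}) r : (r <= #|A|)%N ->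
  exists2 B : {set E}, B \subset A & #|B| = r.
Proof.
move=> rA; exists [set x in take r (enum A)].
  by apply/subsetP => x; rewrite inE => /mem_take; rewrite mem_enum.
rewrite cardsE; have /card_uniqP -> : uniq (take r (enum A)) by rewrite take_uniq ?enum_uniq.
by rewrite size_take -cardE; case: ltngtP rA => // ->.
Qed.

Lemma natr_card_fiber (E V : finType) (p : E -> V) (A : {set E}) v :
  #|[set e in A | p e == v]|%:R = \sum_(e | p e == v) (e \in A)%:R :> rat.
Proof.
rewrite -sum1_card natr_sum big_mkcond [RHS]big_mkcond; apply: eq_bigr => e _ /=.
by rewrite inE andbC; case: (p e == v) => //=; case: (e \in A).
Qed.

Lemma sum_card_fiber (E V : finType) (p : E -> V) (Z : {set V}) (A : {set E}) :
  (forall e, p e \in Z) -> (\sum_(v in Z) #|[set e in A | p e == v]| = #|A|)%N.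
Proof.
move=> pZ; rewrite -[RHS]sum1_card (partition_big p (mem Z)) //=.
by apply: eq_bigr => v _; rewrite -sum1_card; apply: eq_bigl => e; rewrite inE.
Qed.

(** Deleting all edges of a cut with fewer than [l] edges would leave [S] closed under adjacency,
    against connectedness. *)
Lemma edge_connected_cut (G : multigraph) (l : nat) (T : factor G) (xe ye : edge G -> vertex G)
    (S : {set vertex G}) :
  (forall e, ends e = [set xe e; ye e]) -> edge_connected l T -> S != set0 -> S != setT ->
  (l <= #|[set e in T | (xe e \in S) (+) (ye e \in S)]|)%N.
Proof.
move=> endsE conn /set0Pn[u uS] ST.
have [v vS] : exists v, v \notin S.
  apply/existsP; rewrite -negb_forall; apply: contra ST => /forallP h.
  by apply/eqP/setP => v; rewrite h inE.
set D := [set e in T | _]; rewrite leqNgt; apply/negP => Dl.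
have DT : D \subset T by apply/subsetP => e; rewrite inE => /andP[].
suff cl : closed (adj (T :\: D)) (mem S).
  by have := closed_connect cl (conn D DT Dl u v); rewrite uS (negPf vS).
move=> a b /existsP[e /andP[]]; rewrite !inE negb_and => /andP[nD eT] /eqP.
rewrite endsE => eE; move: nD; rewrite eT /= => nD.
have xyS : (xe e \in S) = (ye e \in S) by move: nD; case: (xe e \in S); case: (ye e \in S).
have : a \in [set a; b] by rewrite !inE eqxx.
have : b \in [set a; b] by rewrite !inE eqxx orbT.
by rewrite -eE !inE => /orP[/eqP->|/eqP->] /orP[/eqP->|/eqP->].
Qed.

(* [AB.1] makes the degree of [T] even, [AB.2] carries the part of [f] that [F] and half of the
   enlarged [T] do not cover. *)
Lemma select_edges (E : finType) (F F0 T P : {set E}) (f : int) :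
  [disjoint F & F0] -> [disjoint F & T] -> [disjoint F0 & T] ->
  #|F :&: P|%:R + #|T :&: P|%:R / 2%:R <= f%:~R :> rat ->
  f%:~R <= #|P|%:R - #|F0 :&: P|%:R - #|T :&: P|%:R / 2%:R :> rat ->
  exists AB : {set E} * {set E},
    [/\ AB.1 \subset P :\: (F :|: F0 :|: T), AB.2 \subset P :\: (F :|: F0 :|: T),
        [disjoint AB.1 & AB.2], #|AB.1| = odd #|T :&: P| &
        f = (#|F :&: P| + #|AB.2| + uphalf #|T :&: P|)%N%:Z].
Proof.
move=> FF0 FT F0T lo hi; set M := P :\: _.
have cM : (#|M| + #|F :&: P| + #|F0 :&: P| + #|T :&: P| = #|P|)%N.
  have cE (Z : {set E}) : #|Z| = (\sum_e (e \in Z))%N.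
    by rewrite -sum1_card big_mkcond; apply: eq_bigr => e _; case: (e \in Z).
  rewrite !cE -!big_split /=; apply: eq_bigr => e _.
  rewrite !inE; case: (boolP (e \in F)) => eF; case: (boolP (e \in F0)) => eF0;
    case: (boolP (e \in T)) => eT; case: (e \in P) => //=.
  - by rewrite (disjointFr FF0 eF) in eF0.
  - by rewrite (disjointFr FF0 eF) in eF0.
  - by rewrite (disjointFr FT eF) in eT.
  - by rewrite (disjointFr F0T eF0) in eT.
have oT := odd_double_half #|T :&: P|.
have uE : uphalf #|T :&: P| = (odd #|T :&: P| + #|T :&: P|./2)%N by rewrite uphalf_half.
have lo' : (2 * #|F :&: P|%:Z + #|T :&: P|%:Z <= 2 * f)%R.
  rewrite -(ler_int rat) rmorphD !rmorphM /= -!pmulrn; move: lo; lra.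
have hi' : (2 * f <= 2 * #|P|%:Z - 2 * #|F0 :&: P|%:Z - #|T :&: P|%:Z)%R.
  rewrite -(ler_int rat) !rmorphB !rmorphM /= -!pmulrn; move: hi; lra.
(* The absolute value is exact: [lo'] and integrality of [f] give
   [f >= #|F :&: P| + uphalf #|T :&: P|]. *)
pose r := `|(f - (#|F :&: P| + uphalf #|T :&: P|)%N%:Z)%R|%N.
have rE : f = (#|F :&: P| + r + uphalf #|T :&: P|)%N%:Z by rewrite /r; lia.
(* The upper bound reads [2 r + odd #|T :&: P| <= 2 #|M|]; integrality strengthens it so that the
   parity edge also fits. *)
have rM : (r + odd #|T :&: P| <= #|M|)%N by lia.
have [A AM cA] : exists2 A : {set E}, A \subset M & #|A| = odd #|T :&: P|.
  by apply: subset_of_card; lia.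
have [B BM cB] : exists2 B : {set E}, B \subset M :\: A & #|B| = r.
  by apply: subset_of_card; have := cardsID A M; rewrite (setIidPr AM) cA; lia.
exists (A, B); split=> //=.
- by apply: subset_trans BM _; rewrite subsetDl.
- by rewrite disjoint_sym; move: BM; rewrite subsetD => /andP[].
- by rewrite cB.
Qed.

Theorem theorem6p8 (k : nat) (k_gt0 : (0 < k)%N)
    (G : multigraph) (X Y : {set vertex G}) (bipG : bipartition X Y)
    (f : vertex G -> int)
    (fXY : (\sum_(v in Y) f v = \sum_(v in X) f v %[mod k%:Z])%Z)
    (F F0 T : factor G)
    (FF0 : [disjoint F & F0]) (FT : [disjoint F & T]) (F0T : [disjoint F0 & T])
    (fX : forall v, v \in X ->
       (deg F v)%:R + (deg T v)%:R / 2%:R <= (f v)%:~R :> rat /\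
       (f v)%:~R <= (deg [set: edge G] v)%:R - (deg F0 v)%:R
                    - (deg T v)%:R / 2%:R :> rat)
    (connT : edge_connected (3 * k - 3)%N T) :
  exists H : factor G,
    let H0 : factor G := ~: H in
    [/\ F \subset H, [disjoint H & F0],
        forall v, v \in X -> (deg H v)%:Z = f v &
        forall v, v \in Y ->
          ((deg H v)%:Z = f v %[mod k%:Z])%Z /\
          (deg T v)%:R / 2%:R - k%:R
            < Num.min ((deg H v)%:R - (deg F v)%:R)
                      ((deg H0 v)%:R - (deg F0 v)%:R) :> rat].
Proof.
have [XYT XY /fin_all_exists[xe /fin_all_exists[ye xyP]]] := bipG.
have xX e : xe e \in X by case: (xyP e).
have yY e : ye e \in Y by case: (xyP e).
have endsE e : ends e = [set xe e; ye e] by case: (xyP e).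
have degX (A : factor G) v : v \in X -> deg A v = #|[set e in A | xe e == v]|.
  move=> vX; apply: eq_card => e; rewrite !inE endsE !inE; congr (_ && _).
  have /negPf-> : v != ye e by apply: contraTneq vX => ->; rewrite (disjointFl XY).
  by rewrite orbF eq_sym.
have degY (A : factor G) v : v \in Y -> deg A v = #|[set e in A | ye e == v]|.
  move=> vY; apply: eq_card => e; rewrite !inE endsE !inE; congr (_ && _).
  have /negPf-> : v != xe e by apply: contraTneq vY => ->; rewrite (disjointFr XY).
  by rewrite eq_sym.
have /fin_all_exists[AB ABP] v : exists AB : {set edge G} * {set edge G}, v \in X ->
    [/\ AB.1 \subset [set e | xe e == v] :\: (F :|: F0 :|: T),
        AB.2 \subset [set e | xe e == v] :\: (F :|: F0 :|: T),
        [disjoint AB.1 & AB.2], #|AB.1| = odd (deg T v) &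
        f v = (deg F v + #|AB.2| + uphalf (deg T v))%N%:Z].
  case: (boolP (v \in X)) => vX; last by exists (set0, set0).
  have dE (A : factor G) : deg A v = #|A :&: [set e | xe e == v]|.
    by rewrite degX //; apply: eq_card => e; rewrite !inE.
  have [lo hi] := fX v vX; rewrite !dE ?setTI in lo hi *.
  have [AB ABv] := select_edges FF0 FT F0T lo hi.
  by exists AB.
(* Each edge has a single end in [X], so the choices at the vertices of [X] glue together: [A]
   repairs the parity of [T], and [N] joins [F] among the edges of value 1. *)
pose A := [set e | e \in (AB (xe e)).1]; pose N := [set e | e \in (AB (xe e)).2].
have AM e : e \in A -> [/\ e \notin F, e \notin F0, e \notin T & e \notin N].
  rewrite !inE => eA; have [/subsetP/(_ e eA) + _ dAB _ _] := ABP _ (xX e).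
  by rewrite !inE !negb_or (disjointFr dAB eA) => /andP[/andP[/andP[-> ->] ->]].
have NM e : e \in N -> [/\ e \notin F, e \notin F0 & e \notin T].
  rewrite !inE => eN; have [_ /subsetP/(_ e eN) + _ _ _] := ABP _ (xX e).
  by rewrite !inE !negb_or => /andP[/andP[/andP[-> ->] ->]].
have cA v : v \in X -> #|[set e in A | xe e == v]| = odd (deg T v).
  move=> vX; have [/subsetP sA _ _ <- _] := ABP v vX; apply: eq_card => e; rewrite !inE.
  apply/andP/idP => [[eA /eqP <- //]|eA].
  by have := sA e eA; rewrite !inE => /andP[_ /eqP ev]; rewrite ev eqxx.
have cN v : v \in X -> #|[set e in N | xe e == v]| = #|(AB v).2|.
  move=> vX; have [_ /subsetP sA _ _ _] := ABP v vX; apply: eq_card => e; rewrite !inE.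
  apply/andP/idP => [[eA /eqP <- //]|eA].
  by have := sA e eA; rewrite !inE => /andP[_ /eqP ev]; rewrite ev eqxx.
pose T' := T :|: A.
have T'E e : (e \in T')%:R = (e \in T)%:R + (e \in A)%:R :> rat.
  rewrite in_setU; case: (boolP (e \in A)) => [/AM[_ _ /negPf-> _]|_]; rewrite ?add0r //.
  by rewrite orbF addr0.
pose d (p : edge G -> vertex G) (Z : {set edge G}) v : rat := \sum_(e | p e == v) (e \in Z)%:R.
have dT' p v : d p T' v = d p T v + d p A v.
  by rewrite /d -big_split; apply: eq_bigr => e _; apply: T'E.
have dXE (Z : factor G) v : v \in X -> (deg Z v)%:R = d xe Z v by move=> vX; rewrite degX // natr_card_fiber.
have dYE (Z : factor G) v : v \in Y -> (deg Z v)%:R = d ye Z v by move=> vX; rewrite degY // natr_card_fiber.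
have fE v : v \in X -> (f v)%:~R = d xe F v + d xe N v + d xe T' v / 2%:R.
  move=> vX; have [_ _ _ _ ->] := ABP v vX.
  rewrite -pmulrn !natrD -(cN v vX) natr_card_fiber -/(d xe N v) dXE //; congr (_ + _).
  rewrite dT' -[d xe A v]natr_card_fiber (cA v vX) -dXE // uphalf_half natrD.
  rewrite -{3}(odd_double_half (deg T v)) natrD -mul2n natrM; by field.
have ev x : x \in X -> ~~ odd #|[set e in T' | xe e == x]|.
  move=> vX; suff -> : #|[set e in T' | xe e == x]| = (deg T x + odd (deg T x))%N.
    by rewrite oddD oddb addbb.
  apply/eqP; rewrite -(eqr_nat rat) natrD -(cA x vX) dXE // !natr_card_fiber.
  by rewrite -[\sum_(e | _) _]/(d xe T' x) dT'.
have cut S : S != set0 -> S != setT ->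
    (3 * k - 3 <= #|[set e in T' | (xe e \in S) (+) (ye e \in S)]|)%N.
  move=> S0 ST; apply: leq_trans (edge_connected_cut endsE connT S0 ST) _.
  by apply/subset_leq_card/subsetP => e; rewrite !inE => /andP[-> ->].
(* This is the excess that would give [y] degree exactly [f y]; a shift by multiples of [k] keeps
   the congruence. *)
pose alpha y : rat := (f y)%:~R - d ye F y - d ye N y - d ye T' y / 2%:R.
have aP : {in Y, forall y, exists a : int, alpha y = a%:~R - #|[set e in T' | ye e == y]|%:R / 2%:R}.
  move=> y yY'; exists (f y - #|[set e in F | ye e == y]|%:Z - #|[set e in N | ye e == y]|%:Z).
  by rewrite !rmorphB /= -!pmulrn !natr_card_fiber.
have sumd p (Z : {set edge G}) (Q : {set vertex G}) : (forall e, p e \in Q) -> \sum_(v in Q) d p Z v = #|Z|%:R.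
  move=> pQ; rewrite -(sum_card_fiber Z pQ) natr_sum; apply: eq_bigr => v _.
  by rewrite natr_card_fiber.
have [z zE] : exists z : int, \sum_(v in Y) f v = \sum_(v in X) f v + k%:Z * z.
  have /eqP := fXY; rewrite eqz_mod_dvd => /dvdzP[z zE]; exists z.
  by rewrite mulrC -zE addrC subrK.
(* Counting [F], [N] and half of [T'] from [X] gives the sum of [f] over [X]; counted from [Y] they
   are subtracted in [alpha], so only the difference of the two sums of [f] remains. *)
have sa : \sum_(y in Y) alpha y = k%:R * z%:~R.
  rewrite !sumrB -mulr_suml !sumd // -rmorph_sum /= zE rmorphD rmorphM /= -pmulrn rmorph_sum /=.
  rewrite (eq_bigr _ fE) !big_split /= -mulr_suml !sumd //; ring.
have [g [w [gb gx gy wt wb]]] := bipartite_flow xX yY XY XYT k_gt0 ev cut aP sa.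
pose h e : rat := (e \in F)%:R + (e \in N)%:R + (e \in T')%:R * (2%:R^-1 + g e).
have sumh p v : \sum_(e | p e == v) h e =
    d p F v + d p N v + d p T' v / 2%:R + \sum_(e in T' | p e == v) g e.
  rewrite !big_split /= -[RHS]addrA; congr (_ + _).
  rewrite mulr_suml [X in _ = _ + X]big_mkcondl /= -big_split /=.
  by apply: eq_bigr => e _; case: (e \in T'); rewrite ?mul1r ?mul0r ?addr0.
have hx x : x \in X -> \sum_(e | xe e == x) h e = (f x)%:~R.
  by move=> xX'; rewrite sumh gx // addr0 fE.
have hy y : y \in Y -> \sum_(e | ye e == y) h e = (f y)%:~R - alpha y + w y.
  by move=> yY'; rewrite sumh gy // /alpha; ring.
have dis e : [/\ e \in F -> [/\ e \notin F0, e \notin N & e \notin T'],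
    e \in N -> [/\ e \notin F, e \notin F0 & e \notin T'] & e \in F0 -> e \notin T'].
  split.
  - move=> eF; split; first by rewrite (disjointFr FF0 eF).
      by apply/negP => /NM[]; rewrite eF.
    by rewrite in_setU negb_or (disjointFr FT eF); apply/negP => /AM[]; rewrite eF.
  - move=> eN; have [-> -> eT] := NM e eN; split=> //.
    by rewrite in_setU negb_or eT; apply/negP => /AM[_ _ _]; rewrite eN.
  - move=> eF0; rewrite in_setU negb_or (disjointFr F0T eF0).
    by apply/negP => /AM[_]; rewrite eF0.
have h1 e : e \in F -> h e = 1.
  by move=> eF; have [/(_ eF)[_ /negPf nN /negPf nT] _ _] := dis e; rewrite /h eF nN nT mul0r !addr0.
have h0 e : e \in F0 -> h e = 0.
  move=> eF0; have [_ _ /(_ eF0)/negPf nT] := dis e; rewrite /h nT mul0r addr0.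
  rewrite (disjointFl FF0 eF0) add0r; case: (boolP (e \in N)) => // /NM[_].
  by rewrite eF0.
have h01 e : 0 <= h e <= 1.
  have := gb e; rewrite ler_norml => /andP[g0 g1].
  have [dF dN _] := dis e; rewrite /h.
  case: (boolP (e \in F)) => [/dF[_ /negPf-> /negPf->]|_]; first by rewrite mul0r !addr0 ler01 lexx.
  case: (boolP (e \in N)) => [/dN[_ _ /negPf->]|_]; first by rewrite mul0r addr0 add0r ler01 lexx.
  by case: (e \in T'); rewrite ?mul1r ?mul0r !add0r ?lexx ?ler01 //; apply/andP; split; lra.
have XorY v : v \notin X -> v \in Y by have := in_setT v; rewrite -XYT inE; case: (v \in X).
have hxint v : \sum_(e | xe e == v) h e \is a Num.int.
  case: (boolP (v \in X)) => vX; first by rewrite hx // intr_int.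
  by rewrite big1 ?rpred0 // => e /eqP ev'; rewrite -ev' xX in vX.
have hyint v : \sum_(e | ye e == v) h e \is a Num.int.
  case: (boolP (v \in Y)) => vY; last by rewrite big1 ?rpred0 // => e /eqP ev'; rewrite -ev' yY in vY.
  (* The half-integral parts cancel: [f v - alpha v + w v] is [f v] plus a multiple of [k]. *)
  rewrite hy //; have [t ->] := wt v vY; rewrite addrA subrK rpredD ?intr_int //.
  by rewrite rpredM ?rpred_nat ?intr_int.
have [H [H1 H0 HX HY]] := bipartite_rounding h01 hxint hyint.
exists H; split.
- by apply/subsetP => e /h1/H1.
- by rewrite disjoint_sym; apply/pred0P => e /=; apply/negbTE/negP => /andP[/h0/H0/negPf->].
- by move=> v vX; apply: (@intr_inj rat); rewrite -pmulrn degX // HX hx.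
move=> v vY; have dH : (deg H v)%:R = (f v)%:~R - alpha v + w v by rewrite degY // HY hy.
have [t wE] := wt v vY; split.
  have -> : (deg H v)%:Z = f v + t * k%:Z.
    by apply: (@intr_inj rat); rewrite rmorphD rmorphM /= -!pmulrn dH wE; ring.
  by rewrite addrC modzMDl.
have wv := wb v vY; rewrite ltr_norml in wv; case/andP: wv => w0 w1.
have dge0 (Z : {set edge G}) : 0 <= d ye Z v by apply: sumr_ge0 => e _.
have dle : d ye F v + d ye F0 v + d ye N v + d ye T' v <= d ye setT v.
  rewrite /d -!big_split /=; apply: ler_sum => e _; rewrite in_setT.
  have [dF dN dF0] := dis e.
  case: (boolP (e \in F)) => [/dF[/negPf-> /negPf-> /negPf->]|_]; first by rewrite !addr0.
  case: (boolP (e \in N)) => [/dN[_ /negPf-> /negPf->]|_]; first by rewrite !addr0 !add0r.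
  case: (boolP (e \in F0)) => [/dF0/negPf->|_]; first by rewrite !addr0 !add0r.
  by case: (e \in T'); rewrite !addr0 ?add0r ?ler01.
have dHc : (deg (~: H) v)%:R = d ye setT v - (deg H v)%:R.
  rewrite !dYE // /d -sumrB; apply: eq_bigr => e _; rewrite in_setC in_setT.
  by case: (e \in H); rewrite ?subrr ?subr0.
(* The degree of [H] beyond [F] is [d_N + d_T' / 2 + w], and by [dle] that of the complement beyond
   [F0] is at least [d_T' / 2 - w]. Both exceed [d_T / 2 - k] since [|w| < k] and [d_T' >= d_T]. *)
rewrite lt_min dHc dH !dYE // /alpha; have := dT' ye v; have := dge0 A; have := dge0 N.
by move=> *; apply/andP; split; lra.
Qed.
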